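(* Let $\mathcal H$ be a complex Hilbert space, let $R$ and $P_0$ be bounded positive operators on $\mathcal H$ such that $C=R-P_0$ is a (Hermitian) trace class operator, and let $E$ be an orthogonal projection on $\mathcal H$ with $CE=C$. Put $$\varkappa^{\mathrm o}(C)=\sup\{\operatorname{Tr}(CD)\;:\;0\le D\le E\},\qquad \langle C\rangle_+=\inf\{\operatorname{Tr}(BE)\;:\; B \text{ trace class},\ B\ge 0,\ B\ge C\}.$$ Then: (i) An operator $D^{\mathrm o}$ with $0\le D^{\mathrm o}\le E$ attains the supremum $\varkappa^{\mathrm o}(C)$ if and only if there exists a trace class operator $B^{\mathrm o}$ with $B^{\mathrm o}\ge 0$ and $B^{\mathrm o}\ge C$ such that $$B^{\mathrm o}(E-D^{\mathrm o})=0,\qquad (B^{\mathrm o}-C)D^{\mathrm o}=0 .$$ (ii) Any such $B^{\mathrm o}$ attains the infimum $\langle C\rangle_+$. Conversely, a trace class operator $B^{\mathrm o}$ with $B^{\mathrm o}\ge 0$, $B^{\mathrm o}\ge C$ attains the infimum $\langle C\rangle_+$ if and only if there is an operator $D^{\mathrm o}$, $0\le D^{\mathrm o}\le E$, for which the two equations in (i) hold. (iii) $\varkappa^{\mathrm o}(C)=\langle C\rangle_+$.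
   Context: Operators are bounded linear operators on $\mathcal H$; $A\ge B$ means that $A-B$ is positive semidefinite (Hermitian). The paper writes $\langle C,D\rangle=\operatorname{Tr}(CD)$. *)

(* Defs.v *)
From HB Require Import structures.
From mathcomp Require Import all_boot all_order all_algebra.
From mathcomp Require Import sesquilinear complex.
From mathcomp Require Import all_classical all_reals all_analysis.

Set Implicit Arguments.
Unset Strict Implicit.
Unset Printing Implicit Defensive.

Import Order.TTheory GRing.Theory Num.Theory.
Import numFieldNormedType.Exports.

Local Open Scope classical_set_scope.
Local Open Scope ring_scope.
Local Open Scope complex_scope.

(* [{dot H for Num.conj}] is a positive definite Hermitian form, linear in its
   first argument and conjugate-linear in the second.  The Hilbert space need
   be neither separable nor infinite-dimensional. *)
HB.mixin Record CompleteNormedModule_isHilbert (R : realType) H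
    of CompleteNormedModule R[i] H := {
  inner : {dot H for @Num.conj R[i]} ;
  inner_norm : forall x : H, inner x x = `|x| ^+ 2
}.

#[short(type="hilbertType")]
HB.structure Definition Hilbert (R : realType) :=
  {H of CompleteNormedModule_isHilbert R H & CompleteNormedModule R[i] H}.

Section Operators.
Context {R : realType} {H : hilbertType R}.
Implicit Types (A B C D E S T : H -> H) (b : set H) (f : H -> R[i]).

Definition bounded_op T : Prop :=
  linear T /\ exists M : R, forall x, `|T x| <= M%:C * `|x|.

Definition adjoint T S : Prop := forall x y, inner (T x) y = inner x (S y).

Definition hermitian_op T : Prop := adjoint T T.

(* In the partial order of [R[i]], [0 <= z] says that z is real and
   nonnegative. *)
Definition positive_op T : Prop :=
  [/\ bounded_op T, hermitian_op T & forall x, 0 <= inner (T x) x].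

Definition op_le A B : Prop := positive_op (B \- A).

Definition orthogonal_projection E : Prop :=
  [/\ bounded_op E, hermitian_op E & E \o E = E].

Definition orthonormal_basis b : Prop :=
  (forall u v, b u -> b v -> inner u v = (u == v)%:R) /\
  (forall x, (forall u, b u -> inner x u = 0) -> x = 0).

Definition finite_subsets b : set_system (set H) :=
  filter_from [set F | finite_set F /\ F `<=` b]
    (fun F => [set G | [/\ finite_set G, F `<=` G & G `<=` b]]).

(* Unordered summation, since a basis may be uncountable; [R[i]^o] is [R[i]]
   with the topology of its norm. *)
Definition has_sum b f (s : R[i]) : Prop :=
  (\sum_(e \in F) f e : R[i]^o) @[F --> finite_subsets b] --> (s : R[i]^o).

Definition has_trace T (t : R[i]) : Prop :=
  forall b, orthonormal_basis b -> has_sum b (fun e => inner (T e) e) t.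

(* Junk value 0 when T has no trace; trace class operators have one. *)
Definition trace T : R[i] := xget 0 [set t | has_trace T t].

(* A is the absolute value |T|, the positive square root of T^* T. *)
Definition is_abs T A : Prop :=
  positive_op A /\ exists2 S, adjoint T S & A \o A = S \o T.

(* Tr |T| is finite: the terms of its sum are nonnegative, so convergence in
   [R[i]] is finiteness. *)
Definition trace_class T : Prop :=
  bounded_op T /\ exists A, is_abs T A /\ exists t, has_trace A t.

Definition dual_feasible E D : Prop := positive_op D /\ op_le D E.

Definition primal_feasible C B : Prop :=
  [/\ trace_class B, positive_op B & op_le C B].

(* In the suprema and infima below the traces are real, because both factors
   are Hermitian; [Re] only moves them from [R[i]] to [R]. *)
Definition trace_pair A B : \bar R := (complex.Re (trace (A \o B)))%:E.

Definition kappa_o E C : \bar R :=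
  ereal_sup [set trace_pair C D | D in dual_feasible E].

Definition bracket_plus E C : \bar R :=
  ereal_inf [set trace_pair B E | B in primal_feasible C].

Definition attains_kappa_o E C D : Prop := trace_pair C D = kappa_o E C.

Definition attains_bracket_plus E C B : Prop :=
  trace_pair B E = bracket_plus E C.

Definition complementary E C B D : Prop :=
  B \o (E \- D) = (fun=> 0) /\ (B \- C) \o D = (fun=> 0).

End Operators.

(* Main.v *)
(** Weak duality: [Tr(BE) - Tr(CD) = Tr(B(E - D)) + Tr((B - C)D)], and the trace of
    a product of two positive operators, one of them trace class, is nonnegative and
    vanishes only if the product does.  So a feasible pair has no gap if and only if
    it is complementary, and the theorem follows once one complementary pair is found.

    With [A = |C|], which commutes with [C], and [P] the projection on [ker (A - C)],
    the positive and negative parts of [C] are [AP] and [A(1 - P)], and the pair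
    [B = AP], [D = EP] is complementary.

    The trace of [BD] is handled through [S = sqrt B]: as a pairing of the
    Hilbert-Schmidt operators [S] and [SD] it is independent of the basis and equal to
    [Tr(SDS)]. *)

Require Import Defs.
From mathcomp Require Import all_boot all_order all_algebra.
From mathcomp Require Import sesquilinear complex.
From mathcomp Require Import all_classical all_reals all_analysis.
From mathcomp Require Import finmap ring lra.

Set Implicit Arguments.
Unset Strict Implicit.
Unset Printing Implicit Defensive.

Import Order.TTheory GRing.Theory Num.Theory.
Import numFieldNormedType.Exports.

Local Open Scope classical_set_scope.
Local Open Scope ring_scope.
Local Open Scope complex_scope.

(** * The real inner product *)

(** The only functional calculus is the positive square root. It is a limit of polynomials in the
    operator, so it commutes with every bounded operator that commutes with that one. This gives its
    uniqueness and the commutation of [A] with [C]; then [(A - C)(A + C) = A^2 - C^2 = 0] puts the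
    range of [A + C] inside [ker (A - C)] and takes the place of the spectral theorem. Since [A] and
    [C] have the same square, [C E = C] passes to [A E = A]; hence [E] preserves [ker (A - C)] and
    commutes with [P], so that [E P] lies between [0] and [E].

    The obstacle on the trace side is that [has_trace] asks for one value in all bases, as an
    unordered and possibly uncountable sum of complex terms. Sums of nonnegative terms can be
    rearranged and exchanged freely in the extended reals, and polarization writes the trace of a
    product of two Hilbert-Schmidt operators as a combination of four such sums. *)

Section RealInnerProduct.
Context {R : realType} {H : hilbertType R}.
Implicit Types (x y z : H) (r : R).

Lemma innerDl x y z : inner (x + y) z = inner x z + inner y z.
Proof. exact: linearDl. Qed.

Lemma innerDr z x y : inner z (x + y) = inner z x + inner z y.
Proof. exact: linearDr. Qed.

Lemma innerZl (a : R[i]) x y : inner (a *: x) y = a * inner x y.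
Proof. exact: linearZl_LR. Qed.

Lemma innerC x y : inner y x = (inner x y)^*.
Proof. by rewrite hermC expr0 mul1r. Qed.

Lemma innerZr (a : R[i]) x y : inner x (a *: y) = a^* * inner x y.
Proof. exact: linearZr_LR. Qed.

Lemma innerNl x y : inner (- x) y = - inner x y.
Proof. exact: linearNl. Qed.

Lemma innerNr x y : inner x (- y) = - inner x y.
Proof. exact: linearNr. Qed.

Lemma innerBl x y z : inner (x - y) z = inner x z - inner y z.
Proof. by rewrite innerDl innerNl. Qed.

Lemma innerBr z x y : inner z (x - y) = inner z x - inner z y.
Proof. by rewrite innerDr innerNr. Qed.

Lemma inner0l x : inner 0 x = 0.
Proof. exact: linear0l. Qed.

Lemma inner0r x : inner x 0 = 0.
Proof. exact: linear0r. Qed.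

Definition rnorm x : R := complex.Re `|x|.
Definition rinner x y : R := complex.Re (inner x y).

Lemma normE x : `|x| = (rnorm x)%:C.
Proof. by rewrite RRe_real // normr_real. Qed.

Lemma inner_rnorm x : inner x x = (rnorm x ^+ 2)%:C.
Proof. by rewrite inner_norm normE rmorphXn. Qed.

Lemma rinner_rnorm x : rinner x x = rnorm x ^+ 2.
Proof. by rewrite /rinner inner_rnorm. Qed.

Lemma rnorm_ge0 x : 0 <= rnorm x.
Proof. by rewrite -ler0c -normE. Qed.

Lemma rnorm0 : rnorm 0 = 0.
Proof. by rewrite /rnorm normr0. Qed.

Lemma rnorm_eq0 x : rnorm x = 0 -> x = 0.
Proof. by move=> h; apply/eqP; rewrite -normr_eq0 normE h. Qed.

Lemma rnormD x y : rnorm (x + y) <= rnorm x + rnorm y.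
Proof. by rewrite -lecR rmorphD /= -!normE ler_normD. Qed.

Lemma rnormN x : rnorm (- x) = rnorm x.
Proof. by rewrite /rnorm normrN. Qed.

Lemma rnormBC x y : rnorm (x - y) = rnorm (y - x).
Proof. by rewrite -rnormN opprB. Qed.

Lemma rnormZ (a : R[i]) x : rnorm (a *: x) = complex.Re `|a| * rnorm x.
Proof. by rewrite /rnorm normrZ normE mulrC; case: (`|a|) => b c /=; rewrite mul0r subr0 mulrC. Qed.

Lemma rnormZr r x : rnorm (r%:C *: x) = `|r| * rnorm x.
Proof. by rewrite rnormZ normc_def /= expr0n /= addr0 sqrtr_sqr. Qed.

Lemma rinnerDl x y z : rinner (x + y) z = rinner x z + rinner y z.
Proof. by rewrite /rinner innerDl raddfD. Qed.

Lemma rinnerDr z x y : rinner z (x + y) = rinner z x + rinner z y.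
Proof. by rewrite /rinner innerDr raddfD. Qed.

Lemma rinnerNl x y : rinner (- x) y = - rinner x y.
Proof. by rewrite /rinner innerNl raddfN. Qed.

Lemma rinnerNr x y : rinner x (- y) = - rinner x y.
Proof. by rewrite /rinner innerNr raddfN. Qed.

Lemma rinnerC x y : rinner x y = rinner y x.
Proof. by rewrite /rinner (innerC y x); case: (inner y x). Qed.

Lemma rinnerZl r x y : rinner (r%:C *: x) y = r * rinner x y.
Proof. by rewrite /rinner innerZl; case: (inner x y) => a b /=; rewrite mul0r subr0. Qed.

Lemma rinnerZr r x y : rinner x (r%:C *: y) = r * rinner x y.
Proof. by rewrite rinnerC rinnerZl rinnerC. Qed.

Definition rinnerE :=
  (rinnerDl, rinnerDr, rinnerNl, rinnerNr, rinnerZl, rinnerZr).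

Lemma rinner0l x : rinner 0 x = 0.
Proof. by rewrite /rinner inner0l. Qed.

Lemma rinner0r x : rinner x 0 = 0.
Proof. by rewrite /rinner inner0r. Qed.

Lemma Im_inner x y : complex.Im (inner x y) = rinner x ('i%C *: y).
Proof.
by rewrite /rinner innerZr; case: (inner x y) => a b /=; rewrite mul0r sub0r mulN1r opprK.
Qed.

(** The imaginary part of [inner x y] is the real part at ['i *: y], so identities may be proved for
    [rinner] alone and transferred. *)
Lemma inner_eq x y z t : rinner x y = rinner z t ->
  rinner x ('i%C *: y) = rinner z ('i%C *: t) -> inner x y = inner z t.
Proof.
by rewrite -!Im_inner /rinner; case: (inner x y) (inner z t) => a b [c d] /= -> ->.
Qed.

Lemma rnormD_sqr x y :
  rnorm (x + y) ^+ 2 = rnorm x ^+ 2 + rnorm y ^+ 2 + 2 * rinner x y.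
Proof. by rewrite -!rinner_rnorm !rinnerE (rinnerC y x); ring. Qed.

Lemma rnormB_sqr x y :
  rnorm (x - y) ^+ 2 = rnorm x ^+ 2 + rnorm y ^+ 2 - 2 * rinner x y.
Proof. by rewrite rnormD_sqr rnormN rinnerNr; ring. Qed.

(** The triangle inequality comes with the normed space, so Cauchy-Schwarz is read off from its
    square rather than the other way round. *)
Lemma rinner_le x y : rinner x y <= rnorm x * rnorm y.
Proof.
have := rnormD x y; rewrite -(ler_pXn2r (_ : 0 < 2)%N) ?nnegrE ?addr_ge0 ?rnorm_ge0 //.
by rewrite rnormD_sqr; lra.
Qed.

Lemma rinner_abs_le x y : `|rinner x y| <= rnorm x * rnorm y.
Proof.
by rewrite ler_norml rinner_le andbT lerNl -rinnerNl -(rnormN x) rinner_le.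
Qed.

Lemma rinner_ext x y : (forall z, rinner x z = rinner y z) -> x = y.
Proof.
move=> h; apply/eqP; rewrite -subr_eq0; apply/eqP/rnorm_eq0/eqP.
by rewrite -sqrf_eq0 -rinner_rnorm rinnerDl rinnerNl h subrr.
Qed.

Lemma rnorm_le_sq x r : 0 <= r -> rnorm x ^+ 2 <= r ^+ 2 -> rnorm x <= r.
Proof. by move=> r0; rewrite ler_pXn2r ?nnegrE ?rnorm_ge0. Qed.

End RealInnerProduct.

(** * The projection theorem *)

Section HilbertSpace.
Context {R : realType} {H : hilbertType R}.
Implicit Types (x y z : H) (u : nat -> H).

Lemma le_inv_nat_le0 (a K : R) : (forall n, a <= K / n.+1%:R) -> a <= 0.
Proof.
move=> h; rewrite leNgt; apply/negP => a0.
have K0 : 0 <= K / a by rewrite divr_ge0 ?(ltW a0) //; have := h 0%N; rewrite divr1; lra.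
have := h (Num.truncn (K / a)); rewrite leNgt => /negP; apply.
rewrite ltr_pdivrMr ?ltr0n // mulrC -ltr_pdivrMr //.
by case/andP: (truncn_itv K0).
Qed.

Lemma eq_of_rnorm_le_inv_nat x y (K : R) : (forall n, rnorm (x - y) <= K / n.+1%:R) -> x = y.
Proof.
move=> /le_inv_nat_le0 h; apply/eqP; rewrite -subr_eq0; apply/eqP/rnorm_eq0.
by apply/le_anti; rewrite h rnorm_ge0.
Qed.

Lemma inv_nat_small (K e : R) : 0 <= K -> 0 < e -> exists n, K / n.+1%:R < e.
Proof.
move=> K0 e0; exists (Num.truncn (K / e)).
rewrite ltr_pdivrMr ?ltr0n // mulrC -ltr_pdivrMr //.
by case/andP: (truncn_itv (divr_ge0 K0 (ltW e0))).
Qed.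

(** Completeness enters only here. Limits of vectors are taken with the explicit rate [K / (n + 1)],
    which the limit inherits and which turns later passages to the limit into norm estimates. *)
Lemma cauchy_rate_limit u (K : R) :
  (forall n m, (n <= m)%N -> rnorm (u m - u n) <= K / n.+1%:R) ->
  exists l, forall n, rnorm (l - u n) <= K / n.+1%:R.
Proof.
move=> hu.
have K0 : 0 <= K by have := hu 0%N 0%N (leqnn _); rewrite subrr rnorm0 divr1.
have mono n m : (n <= m)%N -> K / m.+1%:R <= K / n.+1%:R.
  by move=> nm; rewrite ler_wpM2l // lef_pV2 ?posrE ?ltr0n // ler_nat.
have ec (e : R[i]) : 0 < e -> exists2 r : R, 0 < r & e = r%:C.
  move=> e0; exists (complex.Re e); last by rewrite RRe_real // gtr0_real.
  by move: e0; rewrite ltcE => /andP[].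
have : cvg (u n @[n --> \oo]).
  apply/cauchy_cvgP/cauchyP => e /ec[r r0 ->].
  have [N hN] := inv_nat_small K0 r0.
  exists (u N); exists N => // m /= Nm; rewrite -ball_normE /ball_ /=.
  rewrite normE ltcR rnormBC; apply: le_lt_trans hN; exact: hu.
move=> /cvg_ex[/= l ul]; exists l => n.
rewrite -subr_le0; apply: (@le_inv_nat_le0 _ 1) => k.
have k0 : (0 : R[i]) < (1 / k.+1%:R : R)%:C by rewrite ltcR divr_gt0 // ltr0n.
have [N _ hN] := (cvgrPdist_lt _ _).1 ul _ k0.
have := hN (maxn N n) (leq_maxl _ _) => /=; rewrite normE ltcR => h1.
have := hu n (maxn N n) (leq_maxr _ _).
have := rnormD (l - u (maxn N n)) (u (maxn N n) - u n).
rewrite addrA subrK => h2 h3; rewrite lerBlDl (le_trans h2) // addrC lerD // ltW //.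
Qed.

Lemma projection_theorem (M : set H) : M 0 ->
  (forall x y, M x -> M y -> M (x + y)) ->
  (forall (a : R[i]) x, M x -> M (a *: x)) ->
  (forall x, (forall e : R, 0 < e -> exists2 y, M y & rnorm (x - y) <= e) -> M x) ->
  forall x, exists2 m, M m & forall y, M y -> inner (x - m) y = 0.
Proof.
move=> M0 MD MZ Mclosed x.
have MN y : M y -> M (- y) by rewrite -scaleN1r; exact: MZ.
pose S := [set rnorm (x - y) ^+ 2 | y in M].
have S0 : has_inf S.
  split; first by exists (rnorm (x - 0) ^+ 2), 0.
  by exists 0 => _ [y _ <-]; exact: sqr_ge0.
have infS y : M y -> inf S <= rnorm (x - y) ^+ 2.
  by move=> My; apply: ge_inf; [exact: S0.2|exists y].
(* The defect is squared so that distances have rate [1 / (n + 1)]: the parallelogram law bounds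
   [rnorm (u p - u n) ^+ 2] by twice the sum of the two defects, at most [4 / (n + 1)^2], whence the
   constant 2 below. *)
have /choice[u hu] n : exists y, M y /\ rnorm (x - y) ^+ 2 <= inf S + n.+1%:R^-1 ^+ 2.
  have [|_ [y My <-] hy] := @inf_adherent _ S (n.+1%:R^-1 ^+ 2) _ S0.
    by rewrite exprn_gt0 // invr_gt0 ltr0n.
  by exists y; split => //; exact: ltW.
have [|m hm] := @cauchy_rate_limit u 2.
  move=> n p np; apply: rnorm_le_sq; first by rewrite divr_ge0.
  have : M (2^-1%:C *: (u n + u p)) by apply/MZ/MD; [exact: (hu n).1|exact: (hu p).1].
  move=> /infS; set c := 2^-1%:C *: _.
  have -> : x - c = 2^-1%:C *: ((x - u n) + (x - u p)).
    rewrite addrACA -opprD scalerBr scalerDr -scalerDl -rmorphD /=.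
    by have -> : 2^-1 + 2^-1 = 1 :> R; [lra|rewrite scale1r].
  rewrite rnormZr ger0_norm ?invr_ge0// exprMn.
  have -> : u p - u n = (x - u n) - (x - u p) by rewrite opprB [RHS]addrC subrKA.
  have : (p.+1%:R^-1 : R) ^+ 2 <= n.+1%:R^-1 ^+ 2.
    by rewrite ler_pXn2r ?nnegrE ?invr_ge0 // lef_pV2 ?posrE ?ltr0n // ler_nat.
  have := (hu n).2; have := (hu p).2.
  move: (x - u n) (x - u p) (n.+1%:R^-1) (p.+1%:R^-1) => a b s t.
  rewrite rnormB_sqr rnormD_sqr exprMn !exprVn; lra.
have Mm : M m.
  apply: Mclosed => e e0; have [//|n hn] := @inv_nat_small 2 e _ e0.
  by exists (u n); [exact: (hu n).1|apply: le_trans (ltW hn)].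
have hinf : rnorm (x - m) ^+ 2 <= inf S.
  have S1 : 0 <= inf S by apply: lb_le_inf; [exact: S0.1|move=> _ [y _ <-]; exact: sqr_ge0].
  have : rnorm (x - m) <= Num.sqrt (inf S).
    (* The 3 adds the rate 2 of [u n] towards [m] to the rate 1 of the minimizing sequence. *)
    rewrite -subr_le0; apply: (@le_inv_nat_le0 _ 3) => n.
    have := rnormD (x - u n) (u n - m); rewrite subrKA rnormBC => h1.
    have := hm n; have := (hu n).2; have : 0 <= n.+1%:R^-1 :> R by rewrite invr_ge0.
    move: n.+1%:R^-1 h1 => e h1 e0 h2 h3.
    suff : rnorm (x - u n) <= Num.sqrt (inf S) + e.
      by move: h1; rewrite rnormBC (rnormBC (u n)); lra.
    apply: rnorm_le_sq; first by rewrite addr_ge0 ?sqrtr_ge0.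
    by rewrite sqrrD sqr_sqrtr //; have := sqrtr_ge0 (inf S); nra.
  by move=> h; rewrite -(sqr_sqrtr S1) ler_pXn2r ?nnegrE ?rnorm_ge0 ?sqrtr_ge0.
exists m => // y My.
have key z : M z -> rinner (x - m) z = 0.
  move=> Mz; set c := rinner _ _.
  have hq t : 0 <= t ^+ 2 * rnorm z ^+ 2 - 2 * t * c.
    have := infS _ (MD _ _ Mm (MZ t%:C _ Mz)).
    rewrite opprD addrA rnormB_sqr rinnerZr rnormZr exprMn real_normK ?num_real//; lra.
  have [z0|z0] := eqVneq (rnorm z) 0; first by rewrite /c (rnorm_eq0 z0) rinner0r.
  (* The minimizer of the quadratic [hq]; its minimal value is nonnegative only if [c = 0]. *)
  have := hq (c / rnorm z ^+ 2).
  have -> : (c / rnorm z ^+ 2) ^+ 2 * rnorm z ^+ 2 - 2 * (c / rnorm z ^+ 2) * c =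
     - (c ^+ 2 / rnorm z ^+ 2) by field.
  rewrite oppr_ge0 pmulr_lle0 ?invr_gt0 ?exprn_gt0 // ?lt_def ?z0 ?rnorm_ge0 //.
  by move=> h; apply/eqP; rewrite -sqrf_eq0; apply/eqP/le_anti; rewrite h sqr_ge0.
by rewrite -(inner0l y); apply: inner_eq; rewrite rinner0l key //; exact: MZ.
Qed.
End HilbertSpace.

(** * Bounded operators and square roots *)

Section BoundedOperators.
Context {R : realType} {H : hilbertType R}.
Implicit Types (x y z : H) (A B S T : H -> H).

Lemma bounded_rnorm T : bounded_op T ->
  exists2 M : R, 0 < M & forall x, rnorm (T x) <= M * rnorm x.
Proof.
move=> [_ [M hM]]; exists (`|M| + 1); first by have := normr_ge0 M; lra.
move=> x; have := hM x; rewrite !normE -rmorphM lecR /= => /le_trans; apply.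
by rewrite ler_wpM2r ?rnorm_ge0 //; have := ler_norm M; lra.
Qed.

Lemma bounded_opP T (M : R) : linear T -> (forall x, rnorm (T x) <= M * rnorm x) ->
  bounded_op T.
Proof. by move=> lT hM; split=> //; exists M => x; rewrite !normE -rmorphM lecR. Qed.

Section Linear.
Variable T : H -> H.
Hypothesis bT : bounded_op T.

Lemma opD x y : T (x + y) = T x + T y.
Proof. by have := bT.1 1 x y; rewrite !scale1r. Qed.

Lemma op0 : T 0 = 0.
Proof. by apply: (addrI (T 0)); rewrite -opD !addr0. Qed.

Lemma opZ (a : R[i]) x : T (a *: x) = a *: T x.
Proof. by have := bT.1 a x 0; rewrite op0 !addr0. Qed.

Lemma opN x : T (- x) = - T x.
Proof. by rewrite -scaleN1r opZ scaleN1r. Qed.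

Lemma opB x y : T (x - y) = T x - T y.
Proof. by rewrite opD opN. Qed.

End Linear.

Lemma bounded_comp S T : bounded_op S -> bounded_op T -> bounded_op (S \o T).
Proof.
move=> bS bT; have [M M0 hM] := bounded_rnorm bS; have [N N0 hN] := bounded_rnorm bT.
apply: (@bounded_opP _ (M * N)) => [a x y|x] /=; first by rewrite bT.1 bS.1.
by apply: le_trans (hM _) _; rewrite -mulrA ler_wpM2l ?(ltW M0).
Qed.

Lemma bounded_add S T : bounded_op S -> bounded_op T -> bounded_op (S \+ T).
Proof.
move=> bS bT; have [M M0 hM] := bounded_rnorm bS; have [N N0 hN] := bounded_rnorm bT.
apply: (@bounded_opP _ (M + N)) => [a x y|x] /=.
  by rewrite bT.1 bS.1 scalerDr addrACA.
by apply: le_trans (rnormD _ _) _; rewrite mulrDl lerD.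
Qed.

Lemma bounded_scale (a : R[i]) T : bounded_op T -> bounded_op (fun x => a *: T x).
Proof.
move=> bT; have [M M0 hM] := bounded_rnorm bT.
apply: (@bounded_opP _ (complex.Re `|a| * M)) => [b x y|x].
  by rewrite bT.1 scalerDr !scalerA mulrC.
rewrite rnormZ -mulrA ler_wpM2l // -ler0c RRe_real ?normr_real //.
Qed.

Lemma bounded_sub S T : bounded_op S -> bounded_op T -> bounded_op (S \- T).
Proof.
move=> bS bT; have -> : S \- T = S \+ (fun x => (-1) *: T x).
  by apply/funext => x /=; rewrite scaleN1r.
exact/bounded_add/bounded_scale.
Qed.

Lemma bounded_id : bounded_op (@id H).
Proof. by apply: (@bounded_opP _ 1) => // x; rewrite mul1r. Qed.

Lemma adjoint_rinner S T x y : adjoint S T -> rinner (S x) y = rinner x (T y).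
Proof. by rewrite /rinner => ->. Qed.

Lemma adjointP S T : bounded_op S -> bounded_op T ->
  (forall x y, rinner (S x) y = rinner x (T y)) -> adjoint S T.
Proof. by move=> bS bT h x y; apply: inner_eq => //; rewrite h (opZ bT). Qed.

Lemma adjoint_sym S T : adjoint S T -> adjoint T S.
Proof. by move=> h x y; rewrite innerC -h -innerC. Qed.

Lemma adjoint_comp S S' T T' : adjoint S S' -> adjoint T T' ->
  adjoint (S \o T) (T' \o S').
Proof. by move=> hS hT x y /=; rewrite hS hT. Qed.

Lemma adjoint_sub S S' T T' : adjoint S S' -> adjoint T T' ->
  adjoint (S \- T) (S' \- T').
Proof. by move=> hS hT x y /=; rewrite innerBl innerBr hS hT. Qed.

Lemma positive_opP T : bounded_op T -> hermitian_op T ->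
  (forall x, 0 <= rinner (T x) x) -> positive_op T.
Proof.
move=> bT hT h; split=> // x; rewrite lecE /= h andbT.
have : inner (T x) x = (inner (T x) x)^* by rewrite -innerC.
by case: (inner _ _) => a b [/eqP]; rewrite -addr_eq0 -mulr2n mulrn_eq0.
Qed.

Lemma positive_rinner T x : positive_op T -> 0 <= rinner (T x) x.
Proof. by move=> [_ _ /(_ x)]; rewrite lecE => /andP[]. Qed.

Lemma positive_bounded T : positive_op T -> bounded_op T. Proof. by case. Qed.

Lemma positive_hermitian T : positive_op T -> hermitian_op T. Proof. by case. Qed.

(** The discriminant argument for the semidefinite form of [T]. It turns information on the
    quadratic form into information on the vector [T x]. *)
Lemma positive_cauchy_schwarz T x y : positive_op T ->
  rinner (T x) y ^+ 2 <= rinner (T x) x * rinner (T y) y.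
Proof.
move=> pT; have bT := positive_bounded pT; have hT := positive_hermitian pT.
set a := rinner (T x) x; set b := rinner (T y) y; set c := rinner _ _.
have a0 : 0 <= a by exact: positive_rinner.
have b0 : 0 <= b by exact: positive_rinner.
have hq t : 0 <= a + 2 * t * c + t ^+ 2 * b.
  have := positive_rinner (x + t%:C *: y) pT.
  rewrite (opD bT) (opZ bT) !rinnerE -/a -/b -/c.
  rewrite (rinnerC (T y) x) -(adjoint_rinner x y hT) -/c; lra.
have [b1|b1] := eqVneq b 0.
  rewrite b1 mulr0; have [->|c0] := eqVneq c 0; first by rewrite expr0n.
  (* With [b = 0] the expression is affine in [t]; this [t] gives it the value -1. *)
  have := hq (- (a + 1) / (2 * c)); rewrite b1.
  have -> : a + 2 * (- (a + 1) / (2 * c)) * c + (- (a + 1) / (2 * c)) ^+ 2 * 0 = -1.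
    by field.
  by lra.
have := hq (- c / b).
have -> : a + 2 * (- c / b) * c + (- c / b) ^+ 2 * b = (a * b - c ^+ 2) / b by field.
by rewrite pmulr_lge0 ?invr_gt0 ?lt_def ?b1 // subr_ge0.
Qed.

Lemma positive_rinner_eq0 T x : positive_op T -> rinner (T x) x = 0 -> T x = 0.
Proof.
move=> pT h; apply: rinner_ext => y; rewrite rinner0l.
apply/eqP; rewrite -sqrf_eq0; apply/eqP/le_anti; rewrite sqr_ge0 andbT.
by apply: le_trans (positive_cauchy_schwarz x y pT) _; rewrite h mul0r.
Qed.

Lemma hermitian_sqr S x : hermitian_op S -> rinner (S (S x)) x = rnorm (S x) ^+ 2.
Proof. by move=> hS; rewrite (adjoint_rinner _ _ hS) rinner_rnorm. Qed.

Lemma hermitian_sqr_eq0 S x : hermitian_op S -> S (S x) = 0 -> S x = 0.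
Proof.
move=> hS h; apply: rnorm_eq0; apply/eqP; rewrite -sqrf_eq0.
by rewrite -hermitian_sqr // h rinner0l.
Qed.

Lemma positive_congr S T : positive_op T -> bounded_op S -> hermitian_op S ->
  positive_op (S \o T \o S).
Proof.
move=> pT bS hS; apply: positive_opP.
- by do 2?apply: bounded_comp => //; exact: positive_bounded.
- by move=> x y /=; rewrite hS (positive_hermitian pT) hS.
- by move=> x /=; rewrite (adjoint_rinner _ _ hS); exact: positive_rinner.
Qed.

End BoundedOperators.

(** * The positive square root: existence, commutation, uniqueness *)

Section SquareRoot.
Context {R : realType} {H : hilbertType R}.
Implicit Types (x y z : H) (u v : nat -> H) (A B S T : H -> H).

Definition rate_cvg u x := exists K : R, forall n, rnorm (x - u n) <= K / n.+1%:R.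

Lemma rate_cvg_unique u x y : rate_cvg u x -> rate_cvg u y -> x = y.
Proof.
move=> [K hK] [L hL]; apply: (@eq_of_rnorm_le_inv_nat _ _ _ _ (K + L)) => n.
have := rnormD (x - u n) (u n - y); rewrite subrKA (rnormBC (u n)) => /le_trans; apply.
by rewrite mulrDl lerD.
Qed.

Lemma rate_cvg_cst x : rate_cvg (fun=> x) x.
Proof. by exists 0 => n; rewrite subrr rnorm0 mul0r. Qed.

Lemma rate_cvgD u v x y : rate_cvg u x -> rate_cvg v y ->
  rate_cvg (fun n => u n + v n) (x + y).
Proof.
move=> [K hK] [L hL]; exists (K + L) => n; rewrite opprD addrACA mulrDl.
by apply: le_trans (rnormD _ _) _; rewrite lerD.
Qed.

Lemma rate_cvg_op T u x : bounded_op T -> rate_cvg u x ->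
  rate_cvg (fun n => T (u n)) (T x).
Proof.
move=> bT [K hK]; have [M M0 hM] := bounded_rnorm bT; exists (M * K) => n.
by rewrite -(opB bT) -mulrA; apply: le_trans (hM _) _; rewrite ler_wpM2l ?(ltW M0).
Qed.

Lemma rate_cvg_rinner u v x y a b : rate_cvg u x -> rate_cvg v y ->
  (forall n, rinner (u n) a = rinner b (v n)) -> rinner x a = rinner b y.
Proof.
move=> [K hK] [L hL] h; apply/eqP; rewrite -subr_eq0 -normr_le0.
apply: (@le_inv_nat_le0 _ _ (K * rnorm a + L * rnorm b)) => n.
have -> : rinner x a - rinner b y = rinner (x - u n) a - rinner b (y - v n).
  by rewrite !rinnerE (h n); ring.
apply: le_trans (ler_normB _ _) _; rewrite mulrDl lerD //.
  by apply: le_trans (rinner_abs_le _ _) _; rewrite mulrAC ler_wpM2r ?rnorm_ge0.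
apply: le_trans (rinner_abs_le _ _) _; rewrite mulrAC mulrC.
by rewrite ler_wpM2r ?rnorm_ge0.
Qed.

(* With [Y = 1 - S] and [Z = 1 - A], [S^2 = A] reads [Y = (Z + Y^2) / 2]: this is the
   Picard iteration of that equation, and [sqrt_gap] is 1 minus the same iteration for
   the scalar [Z = 1], which dominates it in norm. *)
Fixpoint sqrt_iter (Z : H -> H) n x : H :=
  if n is m.+1 then 2^-1%:C *: (Z x + sqrt_iter Z m (sqrt_iter Z m x)) else 0.

Fixpoint sqrt_gap n : R := if n is m.+1 then sqrt_gap m - sqrt_gap m ^+ 2 / 2 else 1.

(** The recursion is the discrete form of [d' = - d^2 / 2], whose solutions decay like [2 / n]. This
    supplies the rate of convergence of the operator iteration. *)
Lemma sqrt_gap_bounds n : 0 <= sqrt_gap n <= 1 /\ sqrt_gap n <= 2 / n.+1%:R.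
Proof.
have -> : 0 <= sqrt_gap n <= 1 by elim: n => [|n] /=; [lra|nra].
(* The induction carries the bound with [n + 2], an equality at [n = 0]; its denominators are at
   least 2, so the bound never exceeds 1. *)
split=> //; suff : sqrt_gap n <= 2 / n.+2%:R.
  by move=> /le_trans; apply; rewrite ler_wpM2l // lef_pV2 ?posrE ?ltr0n // ler_nat.
elim: n => [|n /=]; first by rewrite divff ?pnatr_eq0.
rewrite -(natr1 n.+2); have : 2 <= n.+2%:R :> R by rewrite ler_nat.
move: n.+2%:R => k k2; set d := sqrt_gap n => hd.
have : (d * k <= 2) by rewrite -ler_pdivlMr //; lra.
move=> {}hd; rewrite ler_pdivlMr; last by lra.
have [d1|d1] := leP d (2 / (k + 1)); last first.
  have : 2 < d * (k + 1) by rewrite -ltr_pdivrMr //; lra.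
  nra.
have : d * (k + 1) <= 2 by rewrite -ler_pdivlMr //; lra.
nra.
Qed.

Section Iteration.
Variable Z : H -> H.
Hypothesis pZ : positive_op Z.
Hypothesis Z_le1 : forall x, rnorm (Z x) <= rnorm x.
Local Notation Y := (sqrt_iter Z).
Local Notation d := sqrt_gap.

Lemma sqrt_iter_bounded n : bounded_op (Y n).
Proof.
elim: n => [|n ih]; first by apply: (@bounded_opP _ _ _ 0) => [a x y|x] /=;
  rewrite ?scaler0 ?addr0 // rnorm0 mul0r.
by apply: bounded_scale; apply: bounded_add; [exact: positive_bounded|exact: bounded_comp].
Qed.

Lemma sqrt_iter_rnorm n x : rnorm (Y n x) <= (1 - d n) * rnorm x.
Proof.
elim: n x => [|n ih] x /=; first by rewrite rnorm0 subrr mul0r.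
rewrite rnormZr ger0_norm ?invr_ge0 //; have [/andP[d0 d1] _] := sqrt_gap_bounds n.
have := rnormD (Z x) (Y n (Y n x)); have := Z_le1 x; have := ih (Y n x).
have := ih x; have := rnorm_ge0 x; move: (rnorm x) => r; nra.
Qed.

(** A difference of squares splits as [Y'^2 - Y^2 = Y'(Y' - Y) + (Y' - Y)Y] without commutation.
    Each factor is dominated by its scalar counterpart, and the same identity for scalars closes the
    induction exactly. *)
Lemma sqrt_iter_step n x : rnorm (Y n.+1 x - Y n x) <= (d n - d n.+1) * rnorm x.
Proof.
elim: n x => [|n ih] x.
  rewrite /= subr0 addr0 rnormZr ger0_norm ?invr_ge0 //.
  by have := Z_le1 x; have := rnorm_ge0 x; lra.
have -> : Y n.+2 x - Y n.+1 x = 2^-1%:C *: (Y n.+1 (Y n.+1 x - Y n x) +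
    (Y n.+1 (Y n x) - Y n (Y n x))).
  rewrite (opB (sqrt_iter_bounded n.+1)) subrKA.
  by rewrite -[Y n.+2 x]/(2^-1%:C *: (Z x + Y n.+1 (Y n.+1 x))) {2}/sqrt_iter
    -/sqrt_iter -scalerBr opprD addrACA subrr add0r.
rewrite rnormZr ger0_norm ?invr_ge0 //.
have [/andP[d0 d1] _] := sqrt_gap_bounds n.
have [/andP[e0 e1] _] := sqrt_gap_bounds n.+1.
have dE : d n - d n.+1 = d n ^+ 2 / 2 by rewrite /=; ring.
have eE : d n.+1 - d n.+2 = d n.+1 ^+ 2 / 2 by rewrite -[d n.+2]/(d n.+1 - d n.+1 ^+ 2 / 2); ring.
have h1 : rnorm (Y n.+1 (Y n.+1 x - Y n x)) <= (1 - d n.+1) * ((d n - d n.+1) * rnorm x).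
  by apply: le_trans (sqrt_iter_rnorm _ _) _; rewrite ler_wpM2l // subr_ge0.
have h2 : rnorm (Y n.+1 (Y n x) - Y n (Y n x)) <= (d n - d n.+1) * ((1 - d n) * rnorm x).
  apply: le_trans (ih _) _; rewrite ler_wpM2l ?sqrt_iter_rnorm //.
  by rewrite dE divr_ge0 // sqr_ge0.
rewrite ler_pdivrMl //; apply: le_trans (rnormD _ _) _; apply: le_trans (lerD h1 h2) _.
rewrite eE; have -> : d n.+1 = d n - d n ^+ 2 / 2 by [].
by rewrite le_eqVlt; apply/orP; left; apply/eqP; field.
Qed.

Lemma sqrt_iter_diff n m x : (n <= m)%N -> rnorm (Y m x - Y n x) <= (d n - d m) * rnorm x.
Proof.
move=> /subnK <-; elim: (m - n)%N => [|k ih]; first by rewrite !subrr rnorm0 mul0r.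
have := rnormD (Y (k + n).+1 x - Y (k + n) x) (Y (k + n) x - Y n x); rewrite subrKA.
have := sqrt_iter_step (k + n) x; rewrite addSn; move: ih; rewrite !mulrBl; lra.
Qed.

Lemma sqrt_iter_hermitian n x y : rinner (Y n x) y = rinner x (Y n y).
Proof.
elim: n x y => [|n ih] x y /=; first by rewrite rinner0l rinner0r.
by rewrite !rinnerE !ih (adjoint_rinner _ _ (positive_hermitian pZ)).
Qed.

Lemma sqrt_iter_comm T n x : bounded_op T -> (forall z, T (Z z) = Z (T z)) ->
  T (Y n x) = Y n (T x).
Proof.
move=> bT hT; elim: n x => [|n ih] x /=; first by rewrite (op0 bT).
by rewrite (opZ bT) (opD bT) hT !ih.
Qed.

(** The limit satisfies [L = (Z + L^2) / 2], so [S = 1 - L] has square [1 - Z]; it is positive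
    because [L] is a contraction. The iterates are polynomials in [Z], hence the commutation
    clause. *)
Lemma sqrt_iter_limit : exists S : H -> H, [/\ positive_op S,
  forall x, S (S x) = x - Z x &
  forall T, bounded_op T -> (forall x, T (Z x) = Z (T x)) ->
    forall x, T (S x) = S (T x)].
Proof.
have /choice[L hL] x : exists l, forall n, rnorm (l - Y n x) <= 2 * rnorm x / n.+1%:R.
  apply: cauchy_rate_limit => n m nm; apply: le_trans (sqrt_iter_diff x nm) _.
  rewrite mulrAC ler_wpM2r ?rnorm_ge0 //.
  have [/andP[m0 _] _] := sqrt_gap_bounds m; have [_ h] := sqrt_gap_bounds n.
  by apply: le_trans h; rewrite gerBl.
have cL x : rate_cvg (fun n => Y n x) (L x) by exists (2 * rnorm x).
have L_le x : rnorm (L x) <= rnorm x.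
  rewrite -subr_le0; apply: (@le_inv_nat_le0 _ _ (2 * rnorm x)) => n.
  have := rnormD (L x - Y n x) (Y n x); rewrite subrK; have := hL x n.
  have := sqrt_iter_rnorm n x; have [/andP[d0 _] _] := sqrt_gap_bounds n.
  have := mulr_ge0 d0 (rnorm_ge0 x); rewrite mulrBl mul1r.
  move: (_ / _) => e; lra.
have bL : bounded_op L.
  apply: (@bounded_opP _ _ _ 1) => [a x y|x]; last by rewrite mul1r.
  apply: rate_cvg_unique (cL _) _.
  have -> : (fun n => Y n (a *: x + y)) = (fun n => a *: Y n x + Y n y).
    by apply/funext => n; rewrite (opD (sqrt_iter_bounded n)) (opZ (sqrt_iter_bounded n)).
  by apply: rate_cvgD (cL y); exact: (rate_cvg_op (bounded_scale a bounded_id) (cL x)).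
have hL' : hermitian_op L.
  apply: adjointP => // x y; apply: rate_cvg_rinner (cL x) (cL y) _ => n.
  exact: sqrt_iter_hermitian.
have fixL x : L x = 2^-1%:C *: (Z x + L (L x)).
  (* The two occurrences of [n] are separated through [Y n (L x)], using that each [Y n] is a
     contraction. *)
  have c1 : rate_cvg (fun n => Y n (Y n x)) (L (L x)).
    exists (2 * rnorm x + 2 * rnorm (L x)) => n.
    have := rnormD (L (L x) - Y n (L x)) (Y n (L x) - Y n (Y n x)); rewrite subrKA.
    rewrite -(opB (sqrt_iter_bounded n)) => /le_trans; apply.
    rewrite mulrDl addrC lerD ?hL //; apply: le_trans (sqrt_iter_rnorm _ _) _.
    apply: le_trans (hL x n); rewrite ler_piMl ?rnorm_ge0 //.
    by have [/andP[d0 _] _] := sqrt_gap_bounds n; lra.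
  have c2 := rate_cvg_op (bounded_scale 2^-1%:C bounded_id)
    (rate_cvgD (rate_cvg_cst (Z x)) c1).
  apply: rate_cvg_unique c2; exists (2 * rnorm x) => n /=.
  rewrite -[2^-1%:C *: _]/(Y n.+1 x); apply: le_trans (hL x n.+1) _.
  rewrite ler_wpM2l // ?mulr_ge0 ?rnorm_ge0 // lef_pV2 ?posrE ?ltr0n // ler_nat.
  exact: leqnSn.
exists (id \- L); split.
- apply: positive_opP => [||x /=].
  + exact: bounded_sub bounded_id bL.
  + exact: adjoint_sub.
  + rewrite rinnerDl rinnerNl rinner_rnorm subr_ge0.
    by apply: le_trans (rinner_le _ _) _; rewrite expr2 ler_wpM2r ?rnorm_ge0.
- move=> x /=; rewrite (opB bL).
  have e : L x + L x = Z x + L (L x).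
    rewrite {1 2}[L x]fixL -scalerDl -rmorphD /=.
    by have -> : 2^-1 + 2^-1 = 1 :> R; [lra|rewrite scale1r].
  have -> : L (L x) = L x + L x - Z x by rewrite e addrC addKr.
  by rewrite opprB [_ - Z x - L x]addrAC addrK addrA subrK.
- move=> T bT hT x /=; rewrite (opB bT); congr (_ - _).
  have c1 := rate_cvg_op bT (cL x); apply: rate_cvg_unique c1 _.
  have -> : (fun n => T (Y n x)) = (fun n => Y n (T x)).
    by apply/funext => n; exact: sqrt_iter_comm.
  exact: cL.
Qed.

End Iteration.

(** Dividing by a norm bound [M] puts [Z = 1 - A / M] between 0 and 1, where the iteration applies;
    the root is then multiplied by the square root of [M]. *)
Lemma positive_sqrt A : positive_op A -> exists S : H -> H, [/\ positive_op S,
  forall x, S (S x) = A x &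
  forall T, bounded_op T -> (forall x, T (A x) = A (T x)) ->
    forall x, T (S x) = S (T x)].
Proof.
move=> pA; have bA := positive_bounded pA; have hA := positive_hermitian pA.
have [M M0 hM] := bounded_rnorm bA.
pose Z x := x - M^-1%:C *: A x.
have bZ : bounded_op Z by exact: bounded_sub bounded_id (bounded_scale _ bA).
have rZ x y : rinner (Z x) y = rinner x y - M^-1 * rinner (A x) y by rewrite /Z !rinnerE.
have pZ : positive_op Z.
  apply: positive_opP => // [|x].
    apply: adjointP => // x y; rewrite rZ rinnerC (rinnerC x (Z y)) rZ.
    by rewrite (adjoint_rinner _ _ hA) (rinnerC x).
  rewrite rZ subr_ge0 ler_pdivrMl // rinner_rnorm.
  by apply: le_trans (rinner_le _ _) _; rewrite expr2 mulrA ler_wpM2r ?rnorm_ge0.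
have Zq x : rinner (Z x) x <= rnorm x ^+ 2.
  rewrite rZ rinner_rnorm gerBl mulr_ge0 ?positive_rinner // invr_ge0 ltW //.
(* Cauchy-Schwarz for the form of [Z] at [x] and [Z x] bounds the fourth power of [rnorm (Z x)] by
   [rnorm x ^+ 2 * rnorm (Z x) ^+ 2]. *)
have Zn x : rnorm (Z x) <= rnorm x.
  have [z0|z0] := eqVneq (rnorm (Z x)) 0; first by rewrite z0 rnorm_ge0.
  have := positive_cauchy_schwarz x (Z x) pZ; rewrite rinner_rnorm.
  have := ler_pM (positive_rinner x pZ) (positive_rinner (Z x) pZ) (Zq x) (Zq (Z x)).
  move=> h /le_trans /(_ h); rewrite expr2 ler_pM2r; last first.
    by rewrite exprn_gt0 // lt_def z0 rnorm_ge0.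
  by rewrite ler_pXn2r ?nnegrE ?rnorm_ge0.
have [S [pS S2 SC]] := sqrt_iter_limit pZ Zn.
have bS := positive_bounded pS.
exists (fun x => (Num.sqrt M)%:C *: S x); split.
- apply: positive_opP => [||x].
  + exact: bounded_scale.
  + apply: adjointP; try exact: bounded_scale.
    by move=> x y; rewrite !rinnerE (adjoint_rinner _ _ (positive_hermitian pS)).
  + by rewrite rinnerE mulr_ge0 ?sqrtr_ge0 ?positive_rinner.
- move=> x; rewrite (opZ bS) S2 scalerA -rmorphM /= -expr2 sqr_sqrtr ?(ltW M0) //.
  by rewrite /Z opprB addrC subrK scalerA -rmorphM /= divff ?scale1r // gt_eqF.
- move=> T bT hT x; rewrite (opZ bT) SC // => y.
  by rewrite /Z (opB bT) (opZ bT) hT.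
Qed.

(** If [A] and [B] commute and [X = A - B], then [(A + B) X = 0]; by positivity [A X] and [B X] both
    vanish, so [X^2 = 0] and [X = 0]. In general both are compared with the constructed root of
    [A^2 = B^2], which commutes with each of them. *)
Lemma positive_sqr_inj A B : positive_op A -> positive_op B ->
  (forall x, A (A x) = B (B x)) -> A = B.
Proof.
have sqrt_uniq : forall A B : H -> H, positive_op A -> positive_op B ->
    (forall x, A (A x) = B (B x)) -> (forall x, A (B x) = B (A x)) -> A = B.
  move=> {}A {}B pA pB hAB cAB; apply/funext => x.
  have bA := positive_bounded pA; have bB := positive_bounded pB.
  pose X := A \- B; have hX : hermitian_op X.
    by apply: adjoint_sub; exact: positive_hermitian.
  have h0 : A (X x) + B (X x) = 0.
    by rewrite /X /= (opB bA) (opB bB) cAB hAB subrKA subrr.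
  have pa := positive_rinner (X x) pA; have pb := positive_rinner (X x) pB.
  have : rinner (A (X x)) (X x) + rinner (B (X x)) (X x) = 0.
    by rewrite -rinnerDl h0 rinner0l.
  move=> hs; have ha : A (X x) = 0 by apply: positive_rinner_eq0 => //; lra.
  have hb : B (X x) = 0 by apply: positive_rinner_eq0 => //; lra.
  have : X (X x) = 0 by rewrite {1}/X /= ha hb subrr.
  by move=> /(hermitian_sqr_eq0 hX) /eqP; rewrite subr_eq0 => /eqP.
move=> pA pB hAB.
have bA := positive_bounded pA; have bB := positive_bounded pB.
have pA2 : positive_op (A \o A).
  apply: positive_opP => [||x /=]; first exact: bounded_comp.
    by apply: adjoint_comp; exact: positive_hermitian.
  by rewrite hermitian_sqr ?sqr_ge0 //; exact: positive_hermitian.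
have [S [pS S2 SC]] := positive_sqrt pA2.
rewrite (sqrt_uniq A S) //; last first.
  by move=> x; apply: SC.
symmetry; apply: sqrt_uniq => // [x|x]; first by rewrite S2 /= hAB.
by apply: SC => // y /=; rewrite !hAB.
Qed.

Lemma closed_kernel_projection T : bounded_op T -> exists P : H -> H,
  [/\ orthogonal_projection P, forall x, T (P x) = 0 & forall x, T x = 0 -> P x = x].
Proof.
move=> bT; have [M M0 hM] := bounded_rnorm bT.
have /choice[P hP] x : exists m, T m = 0 /\ forall y, T y = 0 -> inner (x - m) y = 0.
  have [||||m Tm hm] := @projection_theorem _ _ [set z | T z = 0] _ _ _ _ x.
  - exact: op0.
  - by move=> y z /= hy hz; rewrite (opD bT) hy hz addr0.
  - by move=> a y /= hy; rewrite (opZ bT) hy scaler0.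
  - move=> y hy /=; apply: rnorm_eq0; apply/le_anti; rewrite rnorm_ge0 andbT.
    apply: (@le_inv_nat_le0 _ _ M) => n.
    have [|z /= Tz hz] := hy n.+1%:R^-1; first by rewrite invr_gt0 ltr0n.
    have := hM (y - z); rewrite (opB bT) Tz subr0 => /le_trans; apply.
    by rewrite ler_wpM2l ?(ltW M0).
  - by exists m.
(* Orthogonality determines the chosen point, which is what makes the pointwise choice [P]
   linear. *)
have uniq x m : T m = 0 -> (forall y, T y = 0 -> inner (x - m) y = 0) -> P x = m.
  move=> Tm hm; have [TP hPx] := hP x; apply/eqP; rewrite eq_sym -subr_eq0; apply/eqP/rnorm_eq0.
  have Td : T (m - P x) = 0 by rewrite (opB bT) Tm TP subrr.
  apply/eqP; rewrite -sqrf_eq0 -rinner_rnorm /rinner.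
  by rewrite -{1}(subrKA x) -(opprB x m) addrC innerDl innerNl hm // hPx // oppr0 addr0.
have Pid x : T x = 0 -> P x = x by move=> Tx; apply: uniq => // y _; rewrite subrr inner0l.
have lP : linear P.
  move=> a x y; apply: uniq.
    by rewrite (opD bT) (opZ bT) (hP x).1 (hP y).1 scaler0 addr0.
  move=> z Tz; rewrite opprD addrACA -scalerBr innerDl innerZl (hP x).2 // (hP y).2 //.
  by rewrite mulr0 addr0.
have orthP x y : inner (P x) y = inner (P x) (P y).
  apply/eqP; rewrite -subr_eq0 -innerBr innerC (hP y).2 ?(hP x).1 //.
  by rewrite conjc0.
have bP : bounded_op P.
  apply: (@bounded_opP _ _ _ 1) => // x; rewrite mul1r.
  have [z0|z0] := eqVneq (rnorm (P x)) 0; first by rewrite z0 rnorm_ge0.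
  have := rinner_le (P x) x; rewrite /rinner orthP -/(rinner _ _) rinner_rnorm expr2.
  by rewrite ler_pM2l // lt_def z0 rnorm_ge0.
exists P; split=> // [|x]; last exact: (hP x).1.
split=> //; last by apply/funext => x /=; apply: Pid; exact: (hP x).1.
by move=> x y; rewrite orthP [RHS]innerC [in RHS]orthP -innerC.
Qed.

End SquareRoot.

(** * Orthonormal bases *)

Section OrthonormalBases.
Context {R : realType} {H : hilbertType R}.
Implicit Types (x y z : H) (b F G : set H) (s : seq H).

Definition orthonormal_set b := forall u v, b u -> b v -> inner u v = (u == v)%:R.

(** The squared modulus as an element of [R], where the norm of [R[i]] takes its values in
    [R[i]]. *)
Definition abs2 (z : R[i]) : R := complex.Re z ^+ 2 + complex.Im z ^+ 2.

Lemma abs2_ge0 (c : R[i]) : 0 <= abs2 c.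
Proof. by rewrite addr_ge0 ?sqr_ge0. Qed.

Lemma abs2C (c : R[i]) : abs2 c^* = abs2 c.
Proof. by case: c => a c; rewrite /abs2 /= sqrrN. Qed.

(** A maximal orthonormal set is total, since a nonzero orthogonal vector could be normalized and
    added. Without a basis [has_trace] would hold vacuously; uniqueness of traces rests on this. *)
Lemma orthonormal_basis_exists : exists b : set H, orthonormal_basis b.
Proof.
have [|b [bo bmax]] := @Zorn_bigcup H orthonormal_set.
  move=> F FP Ftot u v [A FA Au] [B FB Bv].
  have [AB|BA] := Ftot _ _ FA FB; first exact: (FP _ FB u v (AB _ Au) Bv).
  exact: (FP _ FA u v Au (BA _ Bv)).
exists b; split=> // x xb; apply/rnorm_eq0/eqP; apply: contrapT => /negP x0.
pose e := (rnorm x)^-1%:C *: x.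
have eb u : b u -> inner e u = 0 by move=> bu; rewrite /e innerZl xb // mulr0.
have be u : b u -> inner u e = 0 by move=> bu; rewrite innerC eb // conjc0.
have ee : inner e e = 1.
  rewrite inner_rnorm /e rnormZr ger0_norm ?invr_ge0 ?rnorm_ge0 // mulVf //.
  by rewrite expr1n.
have nbe : ~ b e by move=> h; have := eb _ h; rewrite ee => /eqP; rewrite oner_eq0.
apply: (bmax (b `|` [set e])).
  by split=> [u bu|h]; [left|apply: nbe; apply: h; right].
move=> u v [bu|->] [bv|->].
- exact: bo.
- by rewrite be //; case: eqP => // ue; move: bu; rewrite ue.
- by rewrite eb //; case: eqP => // ue; move: bv; rewrite -ue.
- by rewrite ee eqxx.
Qed.

Lemma finite_set_seq F : finite_set F -> exists2 s : seq H, uniq s &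
  (forall x, x \in s <-> F x) /\
  forall (V : nmodType) (f : H -> V), \sum_(e \in F) f e = \sum_(e <- s) f e.
Proof.
move=> fF; exists (fset_set F); first exact: fset_uniq.
split=> [x|V f]; last exact: fsbig_finite.
have /(_ x) := in_fset_set fF. by move=> ->; rewrite in_setE.
Qed.

Definition coord_sum s x : H := \sum_(e <- s) inner x e *: e.

Lemma inner_coord_sum b s x y : orthonormal_set b -> uniq s -> (forall e, e \in s -> b e) ->
  b y -> inner (coord_sum s x) y = (y \in s)%:R * inner x y.
Proof.
move=> bo us sb yb; rewrite /coord_sum; elim: s us sb => [|e s ih] /= us sb.
  by rewrite big_nil inner0l mul0r.
move/andP: us => [es us]; rewrite big_cons innerDl innerZl ih //; last first.
  by move=> f fs; apply: sb; rewrite inE fs orbT.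
rewrite [inner e y]bo //; last by apply: sb; rewrite inE eqxx.
rewrite inE; have [->|ye] := eqVneq y e.
  by rewrite (negbTE es) ?eqxx /= mulr1 mul0r addr0 mul1r.
by rewrite mulr0 add0r.
Qed.

Lemma coord_sum_dist b s x : orthonormal_set b -> uniq s -> (forall e, e \in s -> b e) ->
  rnorm (x - coord_sum s x) ^+ 2 = rnorm x ^+ 2 - \sum_(e <- s) abs2 (inner x e).
Proof.
move=> bo; elim: s => [|e s ih] /= us sb.
  by rewrite /coord_sum !big_nil !subr0.
move/andP: us => [es us].
have be : b e by apply: sb; rewrite inE eqxx.
have sb' f : f \in s -> b f by move=> fs; apply: sb; rewrite inE fs orbT.
rewrite {1}/coord_sum !big_cons -/(coord_sum s x) opprD addrA addrAC.
rewrite rnormB_sqr ih // -[rnorm (_ *: _) ^+ 2]rinner_rnorm /rinner.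
rewrite innerZl !innerZr innerBl (inner_coord_sum _ bo) // (negbTE es) [inner e e]bo // eqxx.
rewrite mul0r subr0 mulr1 /abs2; case: (inner x e) => a c /=; ring.
Qed.

Lemma coord_sumD s x y : coord_sum s (x + y) = coord_sum s x + coord_sum s y.
Proof.
rewrite /coord_sum -big_split; apply: eq_bigr => e _.
by rewrite innerDl scalerDl.
Qed.

Lemma coord_sumB s x y : coord_sum s (x - y) = coord_sum s x - coord_sum s y.
Proof.
rewrite /coord_sum -sumrB; apply: eq_bigr => e _.
by rewrite innerBl scalerBl.
Qed.

Lemma coord_sum_dist_le b s x : orthonormal_set b -> uniq s -> (forall e, e \in s -> b e) ->
  rnorm (x - coord_sum s x) <= rnorm x.
Proof.
move=> bo us sb; apply: rnorm_le_sq; first exact: rnorm_ge0.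
by rewrite (coord_sum_dist _ bo) // gerBl sumr_ge0 // => e _; exact: abs2_ge0.
Qed.

(** The vectors recovered by their coordinate sums form a closed subspace containing [b], and by
    totality of [b] only 0 is orthogonal to it. *)
Lemma coord_sum_dense b x (e : R) : orthonormal_basis b -> 0 < e ->
  exists2 s, uniq s & (forall u, u \in s -> b u) /\ rnorm (x - coord_sum s x) <= e.
Proof.
move=> [bo bmax] e0.
pose good s := uniq s /\ forall u, u \in s -> b u.
(* Asking for the bound on all larger finite families makes [M] stable under sums: two families can
   be merged. *)
pose M := [set x | forall e : R, 0 < e -> exists2 s, good s &
  forall t, good t -> {subset s <= t} -> rnorm (x - coord_sum t x) <= e].
suff /(_ e e0)[s [us sb] hs] : M x by exists s => //; split=> //; exact: hs.
have good0 : good [::] by [].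
have good_cat s t : good s -> good t -> good (undup (s ++ t)).
  move=> [_ sb] [_ tb]; split; first exact: undup_uniq.
  by move=> u; rewrite mem_undup mem_cat => /orP[/sb|/tb].
have [||||m Mm hm] := @projection_theorem _ _ M _ _ _ _ x.
- move=> d d0; exists [::] => // t _ _; rewrite -[coord_sum t 0]/(coord_sum t 0).
  rewrite /coord_sum big1 ?subrr ?rnorm0 ?ltW // => u _.
  by rewrite inner0l scale0r.
- move=> y z My Mz d d0; have d2 : 0 < d / 2 by rewrite divr_gt0.
  have [s gs hs] := My _ d2; have [t gt ht] := Mz _ d2.
  exists (undup (s ++ t)); first exact: good_cat.
  move=> w gw sw.
  have := hs w gw; have := ht w gw => /(_ _)h1 /(_ _)h2.
  have -> : y + z - coord_sum w (y + z) = (y - coord_sum w y) + (z - coord_sum w z).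
    by rewrite coord_sumD opprD addrACA.
  apply: le_trans (rnormD _ _) _.
  have : rnorm (y - coord_sum w y) <= d / 2.
    by apply: h2 => u us; apply: sw; rewrite mem_undup mem_cat us.
  have : rnorm (z - coord_sum w z) <= d / 2.
    by apply: h1 => u us; apply: sw; rewrite mem_undup mem_cat us orbT.
  lra.
- move=> a y My d d0.
  have n0 : 0 <= complex.Re `|a| by rewrite -ler0c RRe_real ?normr_real.
  have [|s gs hs] := My (d / (complex.Re `|a| + 1)).
    by rewrite divr_gt0 //; lra.
  exists s => // t gt st.
  have -> : a *: y - coord_sum t (a *: y) = a *: (y - coord_sum t y).
    rewrite scalerBr /coord_sum scaler_sumr; congr (_ - _); apply: eq_bigr => u _.
    by rewrite innerZl scalerA.
  rewrite rnormZ; have := hs t gt st; rewrite ler_pdivlMr; last by lra.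
  by have := rnorm_ge0 (y - coord_sum t y); nra.
- move=> y hy d d0; have d2 : 0 < d / 2 by rewrite divr_gt0.
  have [z Mz yz] := hy _ d2; have [s gs hs] := Mz _ d2.
  exists s => // t gt st; have [ut tb] := gt.
  (* The remainder [y - coord_sum t y] is additive and contracting in [y], so replacing [y] by [z]
     costs at most their distance, uniformly in [t]. *)
  have := coord_sum_dist_le (y - z) bo ut tb; have := hs t gt st.
  have := rnormD (y - z - coord_sum t (y - z)) (z - coord_sum t z).
  rewrite [X in rnorm X <= _]addrACA subrK coord_sumB opprB.
  by rewrite [_ - _ - coord_sum t z]addrAC subrr add0r; lra.
have Mb u : b u -> M u.
  move=> bu d d0; exists [:: u]; first by split=> // v; rewrite inE => /eqP->.
  move=> t [ut tb] sut; have -> : coord_sum t u = u.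
    rewrite /coord_sum (bigD1_seq u) /=; [|by apply: sut; rewrite inE|by []].
    rewrite bo // eqxx scale1r big1_seq ?addr0 // => v /andP[vu vt].
    by rewrite [inner u v]bo //; [rewrite eq_sym (negbTE vu) scale0r|exact: tb].
  by rewrite subrr rnorm0 ltW.
have : x - m = 0 by apply: bmax => u bu; apply: hm; exact: Mb.
by move=> /eqP; rewrite subr_eq0 => /eqP ->.
Qed.

Lemma parseval b x : orthonormal_basis b ->
  \esum_(e in b) (abs2 (inner x e))%:E = (rnorm x ^+ 2)%:E.
Proof.
move=> hb; have bo := hb.1; apply/le_anti/andP; split.
  apply: ge_ereal_sup => _ [F [fF Fb] <-]; have [s us [sF ->]] := finite_set_seq fF.
  rewrite sumEFin lee_fin -subr_ge0.
  by rewrite -(@coord_sum_dist b) ?sqr_ge0 // => e /sF/Fb.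
apply/lee_subgt0Pr => e e0.
have e1 : 0 < Num.sqrt e by rewrite sqrtr_gt0.
have [s us [sb hs]] := coord_sum_dense x hb e1.
apply: esum_ge; exists [set` s].
  by split=> [|u]; [exact: finite_seq|exact: sb].
rewrite -(fsbig_seq _ _ us) sumEFin lee_fin.
have := @coord_sum_dist b s x bo us sb.
have : rnorm (x - coord_sum s x) ^+ 2 <= e.
  by rewrite -(sqr_sqrtr (ltW e0)) ler_pXn2r ?nnegrE ?rnorm_ge0 ?sqrtr_ge0.
lra.
Qed.

(** The squared Hilbert-Schmidt norm, in the extended reals so that it makes sense before finiteness
    is known. *)
Definition hs_sqr b (T : H -> H) : \bar R := \esum_(e in b) (rnorm (T e) ^+ 2)%:E.

(** Parseval on both sides and an exchange of two nonnegative sums. Having two unrelated bases makes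
    the norm basis independent as well. *)
Lemma hs_sqr_adjoint b b' (T T' : H -> H) : orthonormal_basis b -> orthonormal_basis b' ->
  adjoint T T' -> hs_sqr b T = hs_sqr b' T'.
Proof.
move=> hb hb' hT; rewrite /hs_sqr.
under eq_esum => e _ do rewrite -(parseval _ hb').
rewrite esum_esum; last by move=> *; rewrite lee_fin abs2_ge0.
under [RHS]eq_esum => e _ do rewrite -(parseval _ hb).
rewrite esum_esum; last by move=> *; rewrite lee_fin abs2_ge0.
rewrite (@reindex_esum _ _ _ (b' `*`` (fun=> b)) (b `*`` (fun=> b')) (fun k => (k.2, k.1))).
  apply: eq_esum => -[f e] _ /=; congr (_%:E).
  by rewrite hT innerC abs2C.
split.
- by move=> [f e] [].
- by move=> [f e] [f' e'] _ _ [-> ->].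
- by move=> [e f] [/= ? ?]; exists (f, e).
Qed.

End OrthonormalBases.

(** * Traces *)

Section Summation.
Context {R : realType} {H : hilbertType R}.
Implicit Types (b F G : set H) (f g : H -> R[i]) (s t c : R[i]).

#[local] Instance finite_subsets_filter b : ProperFilter (finite_subsets b).
Proof.
apply: filter_from_proper => [|F [fF Fb]]; last by exists F; split.
apply: filter_from_filter => [|F G [fF Fb] [fG Gb]].
  by exists set0; split=> //; exact: finite_set0.
exists (F `|` G); first by split; [rewrite finite_setU|rewrite subUset].
by move=> K [fK]; rewrite subUset => -[FK GK] Kb.
Qed.

Lemma has_sum_unique b f s t : has_sum b f s -> has_sum b f t -> s = t.
Proof. by move=> hs ht; apply: (cvg_unique _ hs ht); exact: norm_hausdorff. Qed.

Lemma eq_has_sum b f g s : (forall e, b e -> f e = g e) -> has_sum b f s -> has_sum b g s.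
Proof.
move=> fg; apply: cvg_trans; apply: near_eq_cvg.
exists set0; first by split=> //; exact: finite_set0.
by move=> F [fF _ Fb]; apply: eq_fsbigr => e /set_mem/Fb/fg.
Qed.

Lemma has_sumD b f g s t : has_sum b f s -> has_sum b g t ->
  has_sum b (fun e => f e + g e) (s + t).
Proof.
move=> hs ht; apply: cvg_trans (cvgD hs ht); apply: near_eq_cvg.
exists set0; first by split=> //; exact: finite_set0.
move=> F [fF _ _]; have [r _ [_ hr]] := finite_set_seq fF.
by rewrite /= fctE !hr -[LHS]big_split.
Qed.

Lemma has_sumZ b f s c : has_sum b f s -> has_sum b (fun e => c * f e) (c * s).
Proof.
move=> hs; apply: cvg_trans (cvgZl_tmp (k := c) hs); apply: near_eq_cvg.
exists set0; first by split=> //; exact: finite_set0.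
move=> F [fF _ _]; have [r _ [_ hr]] := finite_set_seq fF.
by rewrite /= !hr -[LHS]/(c * _) mulr_sumr.
Qed.

Lemma fsum_nneg_subset (f : H -> R) F G : (forall e, 0 <= f e) ->
  finite_set F -> finite_set G -> F `<=` G ->
  (\sum_(x \in F) (f x)%:E <= \sum_(x \in G) (f x)%:E)%E.
Proof.
move=> f0 fF fG FG; rewrite -(esum_fset fG) => [|*]; last by rewrite lee_fin.
by apply: ereal_sup_ubound; exists F.
Qed.

(** Together with [has_sum_esum_le], the bridge between suprema of finite sums, where comparison and
    exchange are easy, and the convergence used in [has_trace]. *)
Lemma esum_has_sum b (f : H -> R) (t : R) : (forall e, 0 <= f e) ->
  \esum_(e in b) (f e)%:E = t%:E -> has_sum b (fun e => (f e)%:C) t%:C.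
Proof.
move=> f0 ht; apply/cvgrPdist_lt => e e0.
have er : e = (complex.Re e)%:C by rewrite RRe_real // gtr0_real.
have r0 : 0 < complex.Re e by rewrite -ltcR -er.
have : ((t - complex.Re e)%:E < \esum_(e in b) (f e)%:E)%E.
  by rewrite ht lte_fin ltrBlDr ltrDl.
move=> /ereal_sup_gt[_ [F [fF Fb] <-] hF]; exists F => //.
move=> G [fG FG Gb] /=.
have : (\sum_(x \in G) (f x)%:E <= t%:E)%E.
  by rewrite -ht; apply: ereal_sup_ubound; exists G.
have := fsum_nneg_subset f0 fF fG FG.
have [s us [_ hs]] := finite_set_seq fG; have [s' us' [_ hs']] := finite_set_seq fF.
move: hF; rewrite !hs !hs' !sumEFin lte_fin !lee_fin => h1 h2 h3.
rewrite -rmorph_sum -rmorphB /= [X in _ < X]er normc_def /= expr0n addr0 sqrtr_sqr ltcR.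
by rewrite ger0_norm; lra.
Qed.

Lemma has_sum_esum_le b (f : H -> R) t : (forall e, 0 <= f e) ->
  has_sum b (fun e => (f e)%:C) t -> (\esum_(e in b) (f e)%:E <= (complex.Re t)%:E)%E.
Proof.
move=> f0 ht; apply: ge_ereal_sup => _ [F [fF Fb] <-].
have [s us [sF hs]] := finite_set_seq fF; rewrite hs sumEFin.
apply/lee_addgt0Pr => e e0; rewrite -EFinD lee_fin.
have ec : (0 : R[i]) < e%:C by rewrite ltcR.
have [F' [fF' Fb'] hF'] := (cvgrPdist_lt _ _).1 ht _ ec.
have fU : finite_set (F `|` F') by rewrite finite_setU.
have := hF' (F `|` F').
have UF : [/\ finite_set (F `|` F'), F' `<=` F `|` F' & F `|` F' `<=` b].
  by split=> //; rewrite subUset.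
move=> /(_ UF) /= hU.
have := fsum_nneg_subset f0 fF fU (@subsetUl _ F F').
have [r ur [rF hr]] := finite_set_seq fU; rewrite !hr hs !sumEFin lee_fin => h1.
move: hU; rewrite hr -rmorph_sum /= => h2.
have := le_lt_trans (normc_ge_Re _) h2; rewrite ltcR raddfB /= ltr_norml.
by lra.
Qed.

End Summation.

(** * Traces of positive operators and of products *)

Section Traces.
Context {R : realType} {H : hilbertType R}.
Implicit Types (b : set H) (A B D S T X Y : H -> H) (s t : R[i]).

Lemma has_trace_unique T s t : has_trace T s -> has_trace T t -> s = t.
Proof.
move=> hs ht; have [b hb] := @orthonormal_basis_exists R H.
exact: has_sum_unique (hs b hb) (ht b hb).
Qed.

Lemma has_trace_trace T t : has_trace T t -> trace T = t.
Proof.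
by move=> ht; apply: xget_unique => // s hs; exact: has_trace_unique hs ht.
Qed.

Lemma has_traceD S T s t : has_trace S s -> has_trace T t -> has_trace (S \+ T) (s + t).
Proof.
move=> hs ht b hb; apply: eq_has_sum (has_sumD (hs b hb) (ht b hb)) => e _.
by rewrite /= innerDl.
Qed.

Lemma has_traceB S T s t : has_trace S s -> has_trace T t -> has_trace (S \- T) (s - t).
Proof.
move=> hs ht b hb; rewrite -(mulN1r t).
have h := has_sumD (hs b hb) (has_sumZ (c := -1) (ht b hb)).
apply: eq_has_sum h => e _.
by rewrite /= innerBl mulN1r.
Qed.

Lemma has_trace0 : has_trace (fun=> 0 : H) 0.
Proof.
move=> b hb; apply: (@eq_has_sum _ _ _ (fun=> (0 : R)%:C)) => [e _|].
  by rewrite inner0l.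
by apply: esum_has_sum => //; exact: esum1.
Qed.

Lemma hs_sqr_basis b b' T T' : orthonormal_basis b -> orthonormal_basis b' ->
  adjoint T T' -> hs_sqr b T = hs_sqr b' T.
Proof. by move=> hb hb' hT; rewrite (hs_sqr_adjoint hb hb hT) -(hs_sqr_adjoint hb' hb hT). Qed.

Lemma hs_sqr_ge0 b T : (0 <= hs_sqr b T)%E.
Proof. by apply: esum_ge0 => e _; rewrite lee_fin sqr_ge0. Qed.

Lemma hs_sqr_le b S T (M : R) : (forall x, rnorm (S x) <= M * rnorm (T x)) ->
  (hs_sqr b T < +oo)%E -> (hs_sqr b S < +oo)%E.
Proof.
move=> hM; have [r hr] : exists r, hs_sqr b T = r by exists (hs_sqr b T).
rewrite hr; case: r hr => // [r|] hr _; last by have := hs_sqr_ge0 b T; rewrite hr.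
apply: (@le_lt_trans _ _ (M ^+ 2 * r)%:E); last exact: ltry.
apply: ge_ereal_sup => _ [F hF <-].
have [s us [_ hs]] := finite_set_seq hF.1.
have : (\sum_(e \in F) (rnorm (T e) ^+ 2)%:E <= r%:E)%E.
  by rewrite -hr; apply: ereal_sup_ubound; exists F.
rewrite !hs !sumEFin !lee_fin => h.
apply: le_trans (_ : \sum_(e <- s) M ^+ 2 * rnorm (T e) ^+ 2 <= _).
  apply: ler_sum => e _; rewrite -exprMn ler_pXn2r ?nnegrE ?rnorm_ge0 //.
  by apply: le_trans (hM e); exact: rnorm_ge0.
by rewrite -mulr_sumr ler_wpM2l ?sqr_ge0.
Qed.

Lemma hs_sqrD b S T : (hs_sqr b S < +oo)%E -> (hs_sqr b T < +oo)%E ->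
  (hs_sqr b (S \+ T)%R < +oo)%E.
Proof.
move=> hS hT.
apply: (@le_lt_trans _ _ (\esum_(e in b)
    ((2 * rnorm (S e) ^+ 2)%:E + (2 * rnorm (T e) ^+ 2)%:E)%E)).
  apply: le_esum => e _; rewrite -EFinD lee_fin /=.
  have := rnormD (S e) (T e); have := rnorm_ge0 (S e + T e).
  move: (rnorm (S e)) (rnorm (T e)) (rnorm _) => a c d h1 h2.
  have : 0 <= (a - c) ^+ 2 by exact: sqr_ge0.
  nra.
rewrite esumD; [|by move=> *; rewrite lee_fin mulr_ge0 ?sqr_ge0..].
have hs2 (Q : H -> H) : (hs_sqr b Q < +oo)%E -> (\esum_(e in b) (2 * rnorm (Q e) ^+ 2)%:E < +oo)%E.
  move=> /(@hs_sqr_le b (fun x => (Num.sqrt 2)%:C *: Q x) _ (Num.sqrt 2)).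
  rewrite /hs_sqr; under eq_esum => e _ do
    rewrite rnormZr ger0_norm ?sqrtr_ge0 // exprMn sqr_sqrtr //.
  by apply=> x; rewrite rnormZr ger0_norm ?sqrtr_ge0.
by apply: lte_add_pinfty; exact: hs2.
Qed.

(** The polarization identity with abstract values [h c], so that the same combination applies to
    single terms and to their sums. *)
Definition polar_comb (h : R[i] -> R) : R[i] :=
  4^-1 * ((h 1)%:C + 'i%C * (h 'i%C)%:C + (-1) * (h (-1))%:C + (- 'i%C) * (h (- 'i%C))%:C).

Lemma inner_polarization (x y : H) :
  inner x y = polar_comb (fun c => rnorm (x + c *: y) ^+ 2).
Proof.
rewrite /polar_comb -!inner_rnorm !(innerDl, innerDr, innerZl, innerZr).
have -> : Num.conj (- 'i%C : R[i]) = 'i%C.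
  by rewrite -[LHS]/(conjc (- 'i%C)) /= oppr0 opprK.
have -> : Num.conj ('i%C : R[i]) = - 'i%C.
  by rewrite -[LHS]/(conjc 'i%C) /=; congr Complex; rewrite oppr0.
rewrite rmorphN rmorph1.
by have := sqr_i R; move: ('i%C : R[i]) => i i2; field: i2.
Qed.

Lemma has_sum_polarization b (u v : H -> H) (h : R[i] -> R) :
  (forall c, conjc c * c = 1 ->
    has_sum b (fun e => (rnorm (u e + c *: v e) ^+ 2)%:C) (h c)%:C) ->
  has_sum b (fun e => inner (u e) (v e)) (polar_comb h).
Proof.
move=> hs; apply: (@eq_has_sum _ _ _ (fun e => polar_comb (fun c => rnorm (u e + c *: v e) ^+ 2))).
  by move=> e _; rewrite -inner_polarization.
have conj_i : conjc ('i%C : R[i]) * 'i%C = 1.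
  by apply/eqP; rewrite eq_complex /=
    !(mul0r, mulr0, mulr1, mulN1r, oppr0, opprK, add0r, addr0, sub0r) !eqxx.
apply: has_sumZ; apply: has_sumD; [apply: has_sumD; [apply: has_sumD|]|].
- by apply: hs; rewrite mulr1; exact: conjc1.
- by apply: has_sumZ; apply: hs.
- by apply: has_sumZ; apply: hs; rewrite mulrN1 -[RHS]opprK; congr (- _); exact: (rmorphN1 conjc).
- by apply: has_sumZ; apply: hs; rewrite mulrN -mulNr -rmorphN opprK.
Qed.

(** In any basis the terms of the two traces are [inner (X e) (Y e)] and [inner (Y' e) (X' e)].
    Polarization reduces them to the Hilbert-Schmidt norms of [X + c Y] and of its adjoint, which
    agree and do not depend on the basis. *)
Lemma has_trace_swap X X' Y Y' b : orthonormal_basis b ->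
  adjoint X X' -> adjoint Y Y' -> (hs_sqr b X < +oo)%E -> (hs_sqr b Y < +oo)%E ->
  exists t, has_trace (Y' \o X) t /\ has_trace (X \o Y') t.
Proof.
move=> hb hX hY fX fY.
pose P c e := X e + c *: Y e; pose P' c e := X' e + conjc c *: Y' e.
have adjP c : adjoint (P c) (P' c).
  move=> x y; rewrite /P /P' innerDl innerDr innerZl innerZr hX hY.
  by rewrite -[Num.conj _]/(conjc _) conjcK.
have /choice[h hP] c : exists h : R, hs_sqr b (P c) = h%:E.
  have : (hs_sqr b (P c) < +oo)%E.
    apply: hs_sqrD => //; apply: hs_sqr_le fY => x.
    by rewrite rnormZ.
  by have := hs_sqr_ge0 b (P c); case: (hs_sqr b (P c)) => // r _ _; exists r.
have sumP b' c : orthonormal_basis b' ->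
    has_sum b' (fun e => (rnorm (P c e) ^+ 2)%:C) (h c)%:C.
  move=> hb'; apply: esum_has_sum => [e|]; first exact: sqr_ge0.
  by rewrite -hP; apply: hs_sqr_basis hb' hb (adjP c).
have sumP' b' c : orthonormal_basis b' ->
    has_sum b' (fun e => (rnorm (P' c e) ^+ 2)%:C) (h c)%:C.
  move=> hb'; apply: esum_has_sum => [e|]; first exact: sqr_ge0.
  by rewrite -hP; symmetry; apply: hs_sqr_adjoint hb hb' (adjP c).
exists (polar_comb h); split=> b' hb'.
  have h1 := @has_sum_polarization b' X Y h (fun c _ => sumP b' c hb').
  by apply: eq_has_sum h1 => e _; rewrite /= (adjoint_sym hY).
have h2 : has_sum b' (fun e => inner (Y' e) (X' e)) (polar_comb h).
  apply: has_sum_polarization => c cc; apply: eq_has_sum (sumP' b' c hb') => e _.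
  (* For [c] of modulus 1 the swapped combination differs from the adjoint [P' c] by a phase only,
     so both traces have the same [h]. *)
  have -> : Y' e + c *: X' e = c *: P' c e.
    by rewrite /P' scalerDr scalerA mulrC cc scale1r addrC.
  congr (_%:C); rewrite rnormZ exprMn.
  suff -> : complex.Re `|c| ^+ 2 = 1 by rewrite mul1r.
  apply: complexI.
  rewrite rmorphXn -[X in X ^+ 2]/((complex.Re `|c|)%:C) RRe_real ?normr_real //.
  by rewrite sqr_normc mulrC cc.
by apply: eq_has_sum h2 => e _; rewrite /= hX.
Qed.

Lemma hs_sqr_sqrt b A S : positive_op A -> hermitian_op S -> (forall x, S (S x) = A x) ->
  hs_sqr b S = \esum_(e in b) (rinner (A e) e)%:E.
Proof.
by move=> pA hS SA; apply: eq_esum => e _; rewrite -SA hermitian_sqr.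
Qed.

Lemma positive_has_trace_lty b A t : positive_op A -> orthonormal_basis b ->
  has_trace A t -> (\esum_(e in b) (rinner (A e) e)%:E < +oo)%E.
Proof.
move=> pA hb ht; apply: le_lt_trans (ltry (complex.Re t)).
apply: has_sum_esum_le => [e|]; first exact: positive_rinner.
apply: eq_has_sum (ht b hb) => e _; rewrite RRe_real //.
by apply: ger0_real; case: pA.
Qed.

(** Finiteness in one basis makes the root of [A] Hilbert-Schmidt, and [A] is the product of that
    root with itself. *)
Lemma positive_has_trace b A : positive_op A -> orthonormal_basis b ->
  (\esum_(e in b) (rinner (A e) e)%:E < +oo)%E -> exists t, has_trace A t.
Proof.
move=> pA hb hA; have [S [pS SA _]] := positive_sqrt pA.
have hS := positive_hermitian pS.
have fS : (hs_sqr b S < +oo)%E by rewrite (hs_sqr_sqrt _ pA hS SA).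
have [t [ht _]] := has_trace_swap hb hS hS fS fS; exists t.
by have -> : A = S \o S by apply/funext => x /=; rewrite SA.
Qed.

Lemma positive_has_trace_le A B t : positive_op A -> positive_op (B \- A) -> positive_op B ->
  has_trace B t -> exists s, has_trace A s.
Proof.
move=> pA pBA pB ht; have [b hb] := @orthonormal_basis_exists R H.
apply: (positive_has_trace pA hb); apply: le_lt_trans (positive_has_trace_lty pB hb ht).
apply: le_esum => e _; rewrite lee_fin -subr_ge0.
by have := positive_rinner e pBA; rewrite rinnerDl rinnerNl.
Qed.

(** A positive operator is its own absolute value, by uniqueness of adjoints and of positive
    roots. *)
Lemma positive_trace_class_has_trace A : positive_op A -> trace_class A ->
  exists t, has_trace A t.
Proof.
move=> pA [_ [B [[pB [S hS BB]] [t ht]]]]; exists t.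
have SA x : S x = A x.
  apply: rinner_ext => y; rewrite rinnerC -(adjoint_rinner _ _ hS).
  by rewrite (adjoint_rinner _ _ (positive_hermitian pA)) rinnerC.
have -> // : A = B; apply: positive_sqr_inj => // x.
by rewrite -[B (B x)]/((B \o B) x) BB /= SA.
Qed.

Lemma positive_trace A t : positive_op A -> has_trace A t ->
  exists r : R, [/\ 0 <= r, t = r%:C & r = 0 -> forall x, A x = 0].
Proof.
move=> pA ht; have [b hb] := @orthonormal_basis_exists R H.
have := positive_has_trace_lty pA hb ht.
have : (0 <= \esum_(e in b) (rinner (A e) e)%:E)%E.
  by apply: esum_ge0 => e _; rewrite lee_fin positive_rinner.
have f0 e : 0 <= rinner (A e) e by exact: positive_rinner.
have tE : has_sum b (fun e => (rinner (A e) e)%:C) t.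
  apply: eq_has_sum (ht b hb) => e _; rewrite RRe_real //.
  by apply: ger0_real; case: pA.
case hr : (\esum_(e in b) _) => [r| |] // r0 _; exists r; split.
- by rewrite lee_fin in r0.
- exact: has_sum_unique tE (esum_has_sum f0 hr).
- move=> r00 x; apply: hb.2 => e be; rewrite (positive_hermitian pA).
  suff -> : A e = 0 by rewrite inner0r.
  apply: positive_rinner_eq0 => //; apply/le_anti; rewrite f0 andbT -lee_fin.
  rewrite -[X in (_ <= X%:E)%E]r00 -hr; apply: esum_ge; exists [set e].
    by split=> // _ ->.
  by rewrite fsbig_set1.
Qed.

Lemma has_trace_mul_bounded B D t : positive_op B -> has_trace B t ->
  bounded_op D -> hermitian_op D -> exists S s,
  [/\ positive_op S, forall x, S (S x) = B x, has_trace (B \o D) s & has_trace (S \o D \o S) s].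
Proof.
move=> pB ht bD hD; have [S [pS SB _]] := positive_sqrt pB.
have [b hb] := @orthonormal_basis_exists R H.
have hS := positive_hermitian pS.
have fS : (hs_sqr b S < +oo)%E.
  by rewrite (hs_sqr_sqrt _ pB hS SB); exact: positive_has_trace_lty ht.
have aSD : adjoint (S \o D) (D \o S) by exact: adjoint_comp.
(* Boundedness of [D] controls [D \o S] directly, but not [S \o D]; the bound is carried over by
   taking adjoints. *)
have fSD : (hs_sqr b (S \o D) < +oo)%E.
  rewrite (hs_sqr_adjoint hb hb aSD); have [M _ hM] := bounded_rnorm bD.
  by apply: hs_sqr_le fS => x; exact: hM.
have [s [h1 h2]] := has_trace_swap hb aSD hS fSD fS.
exists S, s; split=> //.
by have -> : B \o D = S \o (S \o D) by apply/funext => x /=; rewrite SB.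
Qed.

(** If the trace of the positive operator [S D S] is 0, then [S D S = 0]; positivity of [D] gives
    [D S = 0], its adjoint gives [S D = 0], and [B D = S (S D)]. *)
Lemma positive_mul_trace B D t : positive_op B -> positive_op D -> has_trace B t ->
  exists r : R, [/\ 0 <= r, has_trace (B \o D) r%:C & r = 0 -> B \o D = fun=> 0].
Proof.
move=> pB pD ht; have bD := positive_bounded pD; have hD := positive_hermitian pD.
have [S [s [pS SB hs hs']]] := has_trace_mul_bounded pB ht bD hD.
have bS := positive_bounded pS; have hS := positive_hermitian pS.
have [r [r0 rs r00]] := positive_trace (positive_congr pD bS hS) hs'.
exists r; split; [by []|by rewrite -rs|move=> /r00 h].
have DS x : D (S x) = 0.
  apply: positive_rinner_eq0 => //; rewrite -(adjoint_rinner _ _ hS).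
  by rewrite -[S (D (S x))]/((S \o D \o S) x) h rinner0l.
apply/funext => x /=; rewrite -SB.
suff -> : S (D x) = 0 by rewrite op0.
apply: rinner_ext => y; rewrite (adjoint_rinner _ _ hS) (adjoint_rinner _ _ hD) DS.
by rewrite rinner0l rinner0r.
Qed.

End Traces.

(** * Duality *)

Section Duality.
Context {R : realType} {H : hilbertType R}.
Implicit Types (A B C D E P : H -> H).

Lemma orthogonal_projection_positive E : orthogonal_projection E -> positive_op E.
Proof.
move=> [bE hE EE]; apply: positive_opP => // x.
by rewrite -{1}EE /= hermitian_sqr // sqr_ge0.
Qed.

(** [A] is the positive root of [C^2], and [C] commutes with [C^2]. *)
Lemma abs_comm A C : positive_op A -> bounded_op C -> (forall x, A (A x) = C (C x)) ->
  forall x, A (C x) = C (A x).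
Proof.
move=> pA bC AC x; have bA := positive_bounded pA; have hA := positive_hermitian pA.
have pA2 : positive_op (A \o A).
  apply: positive_opP => [||y /=]; [exact: bounded_comp|exact: adjoint_comp|].
  by rewrite hermitian_sqr ?sqr_ge0.
have [S [pS S2 SC]] := positive_sqrt pA2.
have -> : A = S by apply: positive_sqr_inj => // y; rewrite S2.
by rewrite SC // => y /=; rewrite !AC.
Qed.

(** Since [P] fixes the range of [A + C] and [A P = C P], both [2 P A] and [2 A P] equal [A + C]. So
    [P] commutes with [A], the two parts are [P A P] and [(1 - P) A (1 - P)], and their difference
    [2 A P - A] is [C]. *)
Lemma jordan_decomposition A C : positive_op A -> bounded_op C -> hermitian_op C ->
    (forall x, A (A x) = C (C x)) ->
  exists P, [/\ orthogonal_projection P, forall x, P (A x) = A (P x),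
    forall x, A x - C x = 0 -> P x = x, forall x, A (P x) = C (P x) &
    [/\ positive_op (A \o P), positive_op (A \- (A \o P)) &
      C = A \o P \- (A \- (A \o P))]].
Proof.
move=> pA bC hC AC; have bA := positive_bounded pA; have hA := positive_hermitian pA.
have cAC := abs_comm pA bC AC.
have [P [oP TP PT]] := closed_kernel_projection (bounded_sub bA bC).
have [bP hP PP] := oP; have PPx x : P (P x) = P x by rewrite -[RHS]/(P x) -{3}PP.
have AP x : A (P x) = C (P x) by apply/eqP; rewrite -subr_eq0; apply/eqP/TP.
have PA x : P (A x) = P (C x).
  apply: rinner_ext => y; rewrite !(adjoint_rinner _ _ hP).
  by rewrite (adjoint_rinner _ _ hA) (adjoint_rinner _ _ hC) AP.
have Psum x : P (A x + C x) = A x + C x.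
  by apply: PT; rewrite /= (opD bA) (opD bC) AC cAC [X in X - _]addrC subrr.
have PA2 x : P (A x) + P (A x) = A x + C x by rewrite -Psum (opD bP) -PA.
(* The adjoint of [Psum], obtained by moving every operator across the inner product. *)
have AP2 x : A (P x) + A (P x) = A x + C x.
  apply: rinner_ext => y; rewrite {2}AP !rinnerDl.
  rewrite !(adjoint_rinner _ _ hA) !(adjoint_rinner _ _ hC) !(adjoint_rinner _ _ hP).
  by rewrite -!rinnerDr -(opD bP) Psum.
have half x y : x + x = y + y -> x = y :> H.
  have halve z : 2^-1%:C *: (z + z) = z :> H.
    rewrite scalerDr -scalerDl -rmorphD /=.
    by have -> : 2^-1 + 2^-1 = 1 :> R; [lra|rewrite scale1r].
  by move=> h; rewrite -(halve x) h halve.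
have cPA x : P (A x) = A (P x) by apply: half; rewrite PA2 AP2.
exists P; split=> //; split.
- have -> : A \o P = P \o A \o P by apply/funext => x /=; rewrite cPA PPx.
  exact: positive_congr.
- have -> : A \- (A \o P) = (id \- P) \o A \o (id \- P).
    apply/funext => x /=; rewrite (opB bA) (opB bP) !cPA PPx.
    by rewrite subrr subr0.
  apply: positive_congr => //; first exact: bounded_sub bounded_id bP.
  exact: adjoint_sub.
- apply/funext => x /=; rewrite opprB addrA AP2 [A x + _]addrC addrK //.
Qed.

Lemma positive_trace_class A t : positive_op A -> has_trace A t -> trace_class A.
Proof.
move=> pA ht; split; first exact: positive_bounded.
by exists A; split; [split=> //; exists A => //; exact: positive_hermitian|exists t].
Qed.

(** [C] has no sign, so the trace of [C D] is obtained by applying the positive case to [Cp] and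
    [Cm]. The trace of [B E] is then assembled from those of [C D], [B (E - D)] and [(B - C) D]; the
    last two add up to the gap. *)
Lemma duality_gap C Cp Cm sp sm : positive_op Cp -> positive_op Cm ->
    C = Cp \- Cm -> has_trace Cp sp -> has_trace Cm sm ->
  forall E B D, primal_feasible C B -> dual_feasible E D ->
  exists g : R, [/\ 0 <= g, trace_pair B E = (trace_pair C D + g%:E)%E &
    complementary E C B D <-> g = 0].
Proof.
move=> pCp pCm CE hp hm E B D [tB pB pBC] [pD pED].
have [tb hb] := positive_trace_class_has_trace pB tB.
have hC := has_traceB hp hm; rewrite -CE in hC.
have hBC := has_traceB hb hC.
have [g1 [g10 hg1 g1z]] := positive_mul_trace pB pED hb.
have [g2 [g20 hg2 g2z]] := positive_mul_trace pBC pD hBC.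
have [a [_ ha _]] := positive_mul_trace pCp pD hp.
have [c [_ hc _]] := positive_mul_trace pCm pD hm.
have hCD := has_traceB ha hc.
have CDE : (Cp \o D) \- (Cm \o D) = C \o D by rewrite CE.
rewrite {}CDE in hCD.
have hBE := has_traceD hCD (has_traceD hg1 hg2).
have BEE : (C \o D) \+ ((B \o (E \- D)) \+ ((B \- C) \o D)) = B \o E.
  apply/funext => x /=; rewrite (opB (positive_bounded pB)).
  by rewrite subrKA addrCA subrr addr0.
rewrite {}BEE in hBE.
exists (g1 + g2); split; first exact: addr_ge0.
  rewrite /trace_pair (has_trace_trace hBE) (has_trace_trace hCD) -EFinD.
  by rewrite -rmorphB -!rmorphD.
split=> [[h1 h2]|g0].
  have h0 := @has_trace0 R H.
  rewrite h1 in hg1; rewrite h2 in hg2.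
  have [->] := has_trace_unique hg1 h0; have [->] := has_trace_unique hg2 h0.
  by rewrite addr0.
by split; [apply: g1z|apply: g2z]; lra.
Qed.

Lemma complementary_exists C E : trace_class C -> hermitian_op C ->
    orthogonal_projection E -> C \o E = C ->
  exists B D sp sm, [/\ primal_feasible C B, dual_feasible E D, complementary E C B D &
    [/\ positive_op B, positive_op (B \- C), has_trace B sp & has_trace (B \- C) sm]].
Proof.
move=> [bC [A [[pA [S hS AS]] [t ht]]]] hC oE CE.
have [bE hE EE] := oE; have pE := orthogonal_projection_positive oE.
have bA := positive_bounded pA; have hA := positive_hermitian pA.
have CEx x : C (E x) = C x by rewrite -{2}CE.
have EEx x : E (E x) = E x by rewrite -{3}EE.
have AC x : A (A x) = C (C x).
  rewrite -[LHS]/((A \o A) x) AS /=; apply: rinner_ext => y.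
  by rewrite rinnerC -(adjoint_rinner _ _ hS) (adjoint_rinner (C x) y hC) rinnerC.
have [P [oP cPA PT AP [pB pm Cdec]]] := jordan_decomposition pA bC hC AC.
have [bP hP PP] := oP; have PPx x : P (P x) = P x by rewrite -{3}PP.
(* The vector [x - E x] is killed by [C], hence by [C^2 = A^2], hence by the hermitian [A]. *)
have AE x : A (E x) = A x.
  apply/eqP; rewrite eq_sym -subr_eq0 -(opB bA); apply/eqP/(hermitian_sqr_eq0 hA).
  by rewrite AC (opB bC) CEx subrr op0.
(* On [ker (A - C)] one has [A E = A = C = C E], so [E] maps this kernel into itself; taking
   adjoints then gives commutation. *)
have PEP x : P (E (P x)) = E (P x) by apply: PT; rewrite AE CEx AP subrr.
have EP x : E (P x) = P (E x).
  apply: rinner_ext => y; rewrite -PEP.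
  by rewrite !(adjoint_rinner _ _ hP, adjoint_rinner _ _ hE) PEP.
have BC : A \o P \- C = A \- (A \o P).
  by rewrite {1}Cdec; apply/funext => x /=; rewrite opprB addrC subrK.
have [sp hsp] : exists s, has_trace (A \o P) s.
  exact: positive_has_trace_le pB pm pA ht.
have [sm hsm] : exists s, has_trace (A \- (A \o P)) s.
  apply: (positive_has_trace_le pm _ pA ht).
  have -> // : A \- (A \- (A \o P)) = A \o P.
  by apply/funext => x /=; rewrite opprB addrC subrK.
exists (A \o P), (E \o P), sp, sm; rewrite BC; split=> //.
- split=> //; first exact: positive_trace_class hsp.
  by rewrite /op_le BC.
- split.
    have -> : E \o P = P \o E \o P by apply/funext => x /=; rewrite PEP.
    exact: positive_congr.
  rewrite /op_le; have -> : E \- (E \o P) = (id \- P) \o E \o (id \- P).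
    by apply/funext => x /=; rewrite (opB bE) (opB bP) PEP EP subrr subr0.
  apply: positive_congr => //; first exact: bounded_sub bounded_id bP.
  exact: adjoint_sub.
- split; first by apply/funext => x /=; rewrite (opB bP) PEP EP subrr op0.
  by rewrite BC; apply/funext => x /=; rewrite PEP subrr.
Qed.

End Duality.

Theorem theorem1 (R : realType) (H : hilbertType R) (Rop P0 C E : H -> H)
    (hR : positive_op Rop) (hP0 : positive_op P0)
    (hC : C = Rop \- P0) (hCtr : trace_class C)
    (hE : orthogonal_projection E) (hCE : C \o E = C) :
  [/\
    (* (i) *)
    (forall D : H -> H, dual_feasible E D ->
       (attains_kappa_o E C D <->
        exists2 B : H -> H, primal_feasible C B & complementary E C B D)),
    (* (ii) *)
    (forall B D : H -> H, dual_feasible E D -> primal_feasible C B ->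
       complementary E C B D -> attains_bracket_plus E C B),
    (forall B : H -> H, primal_feasible C B ->
       (attains_bracket_plus E C B <->
        exists2 D : H -> H, dual_feasible E D & complementary E C B D)) &
    (* (iii) *)
    kappa_o E C = bracket_plus E C].
Proof.
have herC : hermitian_op C by rewrite hC; apply: adjoint_sub; exact: positive_hermitian.
have [B0 [D0 [sp [sm [pB0 dD0 c00 [posB posBC hsp hsm]]]]]] :=
  complementary_exists hCtr herC hE hCE.
have CB : C = B0 \- (B0 \- C) by apply/funext => x /=; rewrite opprB addrC subrK.
have gap := duality_gap posB posBC CB hsp hsm.
have weak B D : primal_feasible C B -> dual_feasible E D ->
    (trace_pair C D <= trace_pair B E)%E.
  by move=> pB dD; have [g [g0 -> _]] := gap E B D pB dD; rewrite leeDl // lee_fin.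
have tight B D : primal_feasible C B -> dual_feasible E D ->
    (complementary E C B D <-> trace_pair B E = trace_pair C D).
  move=> pB dD; have [g [g0 -> ->]] := gap E B D pB dD.
  rewrite /trace_pair -EFinD; split=> [->|[]]; first by rewrite addr0.
  by move/eqP; rewrite -subr_eq0 addrAC subrr add0r => /eqP.
(* The common value of this one pair bounds every feasible [D] from above and every feasible [B]
   from below, so it is both the supremum and the infimum. *)
have v00 := (tight _ _ pB0 dD0).1 c00.
have kappaE : kappa_o E C = trace_pair C D0.
  apply/le_anti/andP; split; last by apply: ereal_sup_ubound; exists D0.
  by apply: ge_ereal_sup => _ [D dD <-]; rewrite -v00; exact: weak.
have bracketE : bracket_plus E C = trace_pair C D0.
  apply/le_anti/andP; split; first by apply: ereal_inf_lbound; exists B0.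
  by apply: le_ereal_inf_tmp => _ [B pB <-]; exact: weak.
have bracket_of B D : dual_feasible E D -> primal_feasible C B ->
    complementary E C B D -> attains_bracket_plus E C B.
  move=> dD pB /(tight _ _ pB dD) BD; rewrite /attains_bracket_plus bracketE.
  apply/le_anti; rewrite (weak B D0) // andbT BD -v00; exact: weak.
split=> [D dD|B D|B pB|]; [|exact: bracket_of| |by rewrite kappaE bracketE].
- rewrite /attains_kappa_o kappaE; split=> [DD0|[B pB /(tight _ _ pB dD) BD]].
    (* The same [B0] serves every optimal [D]: only the value of [D] matters for closing the gap. *)
    by exists B0 => //; apply/tight => //; rewrite v00.
  by apply/le_anti; rewrite -{1}v00 (weak B0 D) //= -BD weak.
- split=> [|[D dD BD]]; last exact: bracket_of dD pB BD.
  by rewrite /attains_bracket_plus bracketE => BD; exists D0 => //; apply/tight.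
Qed.
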